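(* Let $\mathcal{E}$ be a smooth charted oriented 2-vector bundle of rank $n\ge 1$ over $M$, with objects $E^{\alpha\beta}$ and coherency maps $\phi^{\alpha\beta\gamma}$, equipped with a connective structure $\nabla=(\nabla^{\alpha\beta})$. Applying the strict monoidal functor $\operatorname{Dger}$ to $\mathcal{E}$ yields a charted gerbe with 2-cocycle $\operatorname{Dger}(\phi^{\alpha\beta\gamma}):U_{\alpha\beta\gamma}\to\mathbb{C}^*$. For each $\alpha<\beta$ define a connection on the trivial line bundle $U_{\alpha\beta}\times\mathbb{C}$ by letting its parallel transport along a path $f:[0,1]\to U_{\alpha\beta}$ be $\operatorname{Dger}(P^{\alpha\beta}_f)$, where $P^{\alpha\beta}_f$ is the automorphism of $E^{\alpha\beta}$ given by parallel transport in $U_{\alpha\beta}\times E^{\alpha\beta}$ along $f$ using $\nabla^{\alpha\beta}$. Then these connections form a connective structure on the charted gerbe $\operatorname{Dger}(\mathcal{E})$; that is, they are compatible with the 2-cocycle $\operatorname{Dger}(\phi^{\alpha\beta\gamma})$.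
   Context: Categories. $\mathcal{V}$ has objects $\mathbb{C}^n$ ($n\ge0$) and morphisms $\operatorname{Aut}(\mathbb{C}^n)=\mathrm{Gl}_n(\mathbb{C})$. It is bipermutative under block sum $\oplus$ and tensor product $\otimes$ (lexicographically ordered bases), with permutation matrices as coherence isomorphisms. $M_n(\mathcal{V})$ is the monoidal category of $n\times n$ matrices of objects (morphisms) of $\mathcal{V}$ with product $(E\cdot F)_{ik}=\bigoplus_jE_{ij}\otimes F_{jk}$ and associator given entrywise by the canonical coherence isomorphism of $\mathcal{V}$. Let $R=\mathbb{Z}\times\mathbb{C}^*$ be the commutative ring with addition $(n,a)\oplus(m,b)=(n+m,ab)$ and multiplication $(n,a)\otimes(m,b)=(nm,a^mb^n)$. For a morphism $\phi$ of $M_n(\mathcal{V})$ on the object $(E_{ij})$, $\operatorname{Det}(\phi)\in R$ is the determinant over $R$ of the matrix with entries $(\dim E_{ij},\det\phi_{ij})$. $\mathrm{Gl}_n(\mathcal{V})\subset M_n(\mathcal{V})$ is the full monoidal subcategory of objects $E$ with $\det(\dim E_{ij})\in\{1,-1\}$. For an associator $c$ of $\mathrm{Gl}_n(\mathcal{V})$, $\operatorname{Det}(c)=(\pm1,s)$ with $s\in\{\pm1\}$; put $\operatorname{sgn}(c)=s$. $\mathrm{OGl}_n(\mathcal{V})$ has the same objects as $\mathrm{Gl}_n(\mathcal{V})$ and morphisms $(f,s)$, $f$ a morphism of $\mathrm{Gl}_n(\mathcal{V})$ and $s\in\{\pm1\}$. Composition and product are those of $\mathrm{Gl}_n(\mathcal{V})$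 on $f$ and multiplication on $s$; its associators are $(c,\operatorname{sgn}(c))$. $\mathcal{L}_+^*$ is the strict monoidal category with one object $\mathbb{C}_1$ and automorphisms $\mathbb{C}^*$, composition and monoidal product both being multiplication. $\operatorname{Dger}:\mathrm{OGl}_n(\mathcal{V})\to\mathcal{L}_+^*$ is the strict monoidal functor sending $(f,s)$ with $\operatorname{Det}(f)=(d,a)$, $d\in\{\pm1\}$, to $(sa)^d\in\mathbb{C}^*$. A morphism $f$ of $\mathrm{Gl}_n(\mathcal{V})$ given by parallel transport is regarded as the morphism $(f,+1)$ of $\mathrm{OGl}_n(\mathcal{V})$. Bundles. $M$ is a smooth paracompact manifold with smooth partitions of unity. An ordered open cover $(\mathcal{U},\mathcal{J})$ is an open cover $\{U_\alpha\}_{\alpha\in\mathcal{J}}$ indexed by a partially ordered set such that every finite set of indices with non-empty intersection $U_{\alpha_0\cdots\alpha_p}=U_{\alpha_0}\cap\dots\cap U_{\alpha_p}$ is totally ordered. For a smooth monoidal category $\mathcal{B}$ with discrete objects, a smooth principal $\mathcal{B}$-bundle over $M$ consists of an ordered open cover together with the following data. (1) For $\alpha<\beta$, objects $E^{\alpha\beta}$ of $\mathcal{B}$ with $E^{\alpha\beta}\cdot E^{\beta\gamma}=E^{\alpha\gamma}$ for $\alpha<\beta<\gamma$. (2) Smooth coherency maps $\phi^{\alpha\beta\gamma}:U_{\alpha\beta\gamma}\to\operatorname{Mor}(E^{\alpha\beta}\cdot E^{\beta\gamma},E^{\alpha\gamma})$. (3) On $U_{\alpha\beta\gamma\delta}$: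 $\phi^{\alpha\beta\delta}\circ(\mathrm{id}\cdot\phi^{\beta\gamma\delta})=\phi^{\alpha\gamma\delta}\circ(\phi^{\alpha\beta\gamma}\cdot\mathrm{id})\circ c^{\alpha\beta\gamma\delta}$, with $c^{\alpha\beta\gamma\delta}:E^{\alpha\beta}\cdot(E^{\beta\gamma}\cdot E^{\gamma\delta})\to(E^{\alpha\beta}\cdot E^{\beta\gamma})\cdot E^{\gamma\delta}$ the associator. A smooth charted oriented 2-vector bundle of rank $n$ is a smooth principal $\mathrm{OGl}_n(\mathcal{V})$-bundle. A charted gerbe is a smooth principal $\mathcal{L}_+^*$-bundle, i.e. a smooth Čech 2-cocycle with values in $\mathbb{C}^*$. Strict monoidal functors are applied to bundles by applying them to the objects and coherency maps. Connective structures. A connective structure on a charted (oriented) 2-vector bundle is, for each $\alpha<\beta$, an $n\times n$ matrix $\nabla^{\alpha\beta}$ of smooth connections, the $(i,j)$ entry being on the trivial bundle $U_{\alpha\beta}\times E^{\alpha\beta}_{ij}$, such that for all $\alpha<\beta<\gamma$, $(\phi^{\alpha\beta\gamma})^*\nabla^{\alpha\gamma}=\nabla^{\alpha\beta}\cdot\nabla^{\beta\gamma}$ over $U_{\alpha\beta\gamma}$. Here $(\nabla^{\alpha\beta}\cdot\nabla^{\beta\gamma})_{ik}=\bigoplus_j\nabla^{\alpha\beta}_{ij}\otimes\nabla^{\beta\gamma}_{jk}$, and in the oriented case only the first component of $\phi^{\alpha\beta\gamma}$ (forgetting the sign) is used. A connective structure on a charted gerbe with cocycle $g^{\alpha\beta\gamma}$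 is a family of connections $\nabla^{\alpha\beta}$ on the trivial line bundles $L_{\alpha\beta}=U_{\alpha\beta}\times\mathbb{C}$ such that multiplication by $g^{\alpha\beta\gamma}$, viewed as an isomorphism $L_{\alpha\beta}\otimes L_{\beta\gamma}\to L_{\alpha\gamma}$ over $U_{\alpha\beta\gamma}$, carries $\nabla^{\alpha\beta}\otimes\nabla^{\beta\gamma}$ to $\nabla^{\alpha\gamma}$. *)

(* Defs.v *)
From HB Require Import structures.
From mathcomp Require Import all_boot all_order all_algebra.
From mathcomp Require Import mathcomp_extra boolp classical_sets functions.
From mathcomp Require Import cardinality fsbigop reals topology normedtype derive.
From mathcomp Require Import perm complex mxtens.

Set Implicit Arguments.
Unset Strict Implicit.
Unset Printing Implicit Defensive.

Import Order.TTheory GRing.Theory Num.Theory.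
Import numFieldNormedType.Exports.

Local Open Scope classical_set_scope.
Local Open Scope ring_scope.
Local Open Scope complex_scope.

(* Functions on a subset are represented by total functions of which only the
   values on that subset are constrained. *)

(* C^{k+1}: every directional derivative exists and is C^k.  For V = R or
   V = R^m this is the usual notion, stated without choosing a basis. *)
Fixpoint Ck (R : realType) (V : normedModType R) (k : nat)
    (W : set V) (f : V -> R) : Prop :=
  (forall x, W x -> {for x, continuous f}) /\
  (if k is k'.+1 then
     forall v, (forall x, W x -> derivable f x v) /\ Ck k' W ('D_v f)
   else True).

Definition smooth (R : realType) (V : normedModType R)
    (W : set V) (f : V -> R) : Prop := forall k, Ck k W f.

(* A topological space with a smooth atlas modelled on R^m: [coord i] is the
   chart with domain [dom i] and [param i] its inverse. *)
Record smoothManifold (R : realType) (m : nat) := SmoothManifold {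
  mfd_sort :> topologicalType ;
  chart : Type ;
  dom : chart -> set mfd_sort ;
  coord : chart -> mfd_sort -> 'rV[R]_m ;
  param : chart -> 'rV[R]_m -> mfd_sort ;
  dom_open : forall i, open (dom i) ;
  dom_cover : forall x, exists i, dom i x ;
  coord_open : forall i, open (coord i @` dom i) ;
  coordK : forall i x, dom i x -> param i (coord i x) = x ;
  coord_continuous : forall i x, dom i x -> {for x, continuous (coord i)} ;
  param_continuous : forall i u, (coord i @` dom i) u ->
    {for u, continuous (param i)} ;
  transition_smooth : forall i j a,
    smooth (coord i @` (dom i `&` dom j))
           (fun u => coord j (param i u) ord0 a) ;
  mfd_hausdorff : hausdorff_space mfd_sort
}.

Arguments dom {R m s} _ _.
Arguments coord {R m s} _ _.
Arguments param {R m s} _ _.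

Definition open_cover (T : topologicalType) (I : Type) (V : I -> set T) : Prop :=
  (forall i, open (V i)) /\ (forall x, exists i, V i x).

Definition locally_finite (T : topologicalType) (I : Type) (V : I -> set T) :
    Prop :=
  forall x : T, exists2 N, nbhs x N & finite_set [set i | N `&` V i !=set0].

Definition paracompact (T : topologicalType) : Prop :=
  forall (I : Type) (V : I -> set T), open_cover V ->
  exists (K : Type) (V' : K -> set T),
    [/\ open_cover V', locally_finite V' &
        forall k, exists i, V' k `<=` V i].

Section Manifolds.
Variables (R : realType) (m : nat) (M : smoothManifold R m).
Local Notation C := R[i].

Definition smoothR (W : set M) (g : M -> R) : Prop :=
  forall i, smooth (coord i @` (W `&` dom i)) (g \o param i).

Definition smoothC (W : set M) (g : M -> C) : Prop :=
  smoothR W (fun x => complex.Re (g x)) /\ smoothR W (fun x => complex.Im (g x)).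

Definition smooth_mx p q (W : set M) (G : M -> 'M[C]_(p, q)) : Prop :=
  forall r c, smoothC W (fun x => G x r c).

Definition has_smooth_partitions_of_unity : Prop :=
  forall (I : choiceType) (V : I -> set M), open_cover V ->
  exists rho : I -> M -> R,
    [/\ forall i, smoothR setT (rho i),
        forall i x, 0 <= rho i x,
        forall i, closure [set x | rho i x != 0] `<=` V i,
        locally_finite (fun i => closure [set x | rho i x != 0]) &
        forall x, \sum_(i \in [set: I]) rho i x = 1].

Definition partial (i : chart M) (a : 'I_m) (g : M -> C) (x : M) : C :=
  'D_(delta_mx 0 a) (fun u => complex.Re (g (param i u))) (coord i x) +i*
  'D_(delta_mx 0 a) (fun u => complex.Im (g (param i u))) (coord i x).

Definition partial_mx p q (i : chart M) (a : 'I_m) (G : M -> 'M[C]_(p, q))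
    (x : M) : 'M[C]_(p, q) :=
  \matrix_(r, c) partial i a (fun y => G y r c) x.

(* A connection on the trivial bundle W x C^k is nabla = d + A for a smooth
   gl_k(C)-valued 1-form A on W; [A i a] is the component of A along the a-th
   coordinate vector field of the chart i. *)
Definition conn (k : nat) := chart M -> 'I_m -> M -> 'M[C]_k.

Definition is_connection k (W : set M) (A : conn k) : Prop :=
  (forall i a, smooth_mx (W `&` dom i) (A i a)) /\
  (forall i j a x, W x -> dom i x -> dom j x ->
     A i a x = \sum_(b < m)
       ('D_(delta_mx 0 a) (fun u => coord j (param i u) ord0 b) (coord i x))%:C
         *: A j b x).

Definition eq_conn k (W : set M) (A B : conn k) : Prop :=
  forall i a x, W x -> dom i x -> A i a x = B i a x.

(* Covariant derivative of the section s along the a-th coordinate field. *)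
Definition nabla k (A : conn k) (i : chart M) (a : 'I_m) (s : M -> 'cV[C]_k)
    (x : M) : 'cV[C]_k :=
  partial_mx i a s x + A i a x *m s x.

Definition tensor_conn p q (A : conn p) (B : conn q) : conn (p * q) :=
  fun i a x => A i a x *t 1%:M + 1%:M *t B i a x.

Definition sum_conn n (p : 'I_n -> nat) (A : forall j, conn (p j)) :
    conn (\sum_j p j) :=
  fun i a x => \mxdiag_j A j i a x.

(* phi^* B = A over W, where (phi^* B)(s) = phi^{-1} (B (phi s)). *)
Definition pullback_conn_eq p q (W : set M) (phi : M -> 'M[C]_(q, p))
    (B : conn q) (A : conn p) : Prop :=
  forall s : M -> 'cV[C]_p, smooth_mx W s ->
  forall i a x, W x -> dom i x ->
    nabla B i a (fun y => phi y *m s y) x = phi x *m nabla A i a s x.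

(* A smooth path [0,1] -> W, given as a map smooth on an open interval
   containing [0,1]. *)
Definition smooth_path (W : set M) (f : R -> M) : Prop :=
  (forall t : R, 0 <= t <= 1 -> W (f t)) /\
  exists e : R,
    [/\ 0 < e,
        forall t : R, - e < t < 1 + e -> {for t, continuous f} &
        forall i a,
          smooth [set t : R | (- e < t < 1 + e) /\ dom i (f t)]
                 (fun t : R => coord i (f t) ord0 a)].

Definition is_deriveC (g : R -> C) (t : R) (l : C) : Prop :=
  is_derive t 1 (fun u => complex.Re (g u)) (complex.Re l) /\
  is_derive t 1 (fun u => complex.Im (g u)) (complex.Im l).

Definition velocity (f : R -> M) (i : chart M) (a : 'I_m) (t : R) : R :=
  'D_1 (fun u : R => coord i (f u) ord0 a) t.

(* [P] is the parallel transport of d + A along f : [0,1] -> M: the value at 1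
   of the fundamental solution of T' = - A(f') T, T(0) = 1. *)
Definition transport k (A : conn k) (f : R -> M) (P : 'M[C]_k) : Prop :=
  exists T : R -> 'M[C]_k,
    [/\ T 0 = 1%:M, T 1 = P,
        forall r c,
          {within `[(0 : R), 1], continuous (fun t : R => complex.Re (T t r c))} /\
          {within `[(0 : R), 1], continuous (fun t : R => complex.Im (T t r c))} &
        forall (t : R) i, 0 < t < 1 -> dom i (f t) -> forall r c,
          is_deriveC (fun u => T u r c) t
            ((- (\sum_(a < m) (velocity f i a t)%:C *: A i a (f t)) *m T t)
               r c)].

End Manifolds.

Section Cstar.
Variable R : realType.
Local Notation C := R[i].

Definition Cstar : Type := {z : C | z != 0}.

Definition cstar1 : Cstar := exist _ 1 (oner_neq0 C).

Fact cstar_mul_subproof (a b : Cstar) : val a * val b != 0.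
Proof. by rewrite mulf_neq0 ?(valP a) ?(valP b). Qed.
Definition cstar_mul (a b : Cstar) : Cstar :=
  exist _ (val a * val b) (cstar_mul_subproof a b).

Fact cstar_exp_subproof (a : Cstar) (k : int) : val a ^ k != 0.
Proof. by rewrite expfz_neq0 ?(valP a). Qed.
Definition cstar_exp (a : Cstar) (k : int) : Cstar :=
  exist _ (val a ^ k) (cstar_exp_subproof a k).

(* Signs are booleans: s stands for (-1)^s. *)
Fact cstar_sign_subproof (s : bool) : (-1) ^+ s != 0 :> C.
Proof. by rewrite signr_eq0. Qed.
Definition cstar_sign (s : bool) : Cstar :=
  exist _ ((-1) ^+ s) (cstar_sign_subproof s).

Definition detRing : Type := (int * Cstar)%type.

Definition detRing_add (x y : detRing) : detRing :=
  (x.1 + y.1, cstar_mul x.2 y.2).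
Definition detRing_opp (x : detRing) : detRing := (- x.1, cstar_exp x.2 (-1)).
Definition detRing_mul (x y : detRing) : detRing :=
  (x.1 * y.1, cstar_mul (cstar_exp x.2 y.1) (cstar_exp y.2 x.1)).

Fact detRing_addA : associative detRing_add.
Proof.
move=> [a x] [b y] [c z]; congr (_, _) => /=; first by rewrite addrA.
by apply: val_inj; rewrite /= mulrA.
Qed.
Fact detRing_addC : commutative detRing_add.
Proof.
move=> [a x] [b y]; congr (_, _) => /=; first by rewrite addrC.
by apply: val_inj; rewrite /= mulrC.
Qed.
Fact detRing_add0 : left_id ((0, cstar1) : detRing) detRing_add.
Proof.
move=> [a x]; rewrite /detRing_add /= add0r; congr (_, _).
by apply: val_inj; rewrite /= mul1r.
Qed.
Fact detRing_addN :
  left_inverse ((0, cstar1) : detRing) detRing_opp detRing_add.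
Proof.
move=> [a x]; rewrite /detRing_add /= addNr; congr (_, _).
by apply: val_inj; rewrite /= exprN1 mulVf ?(valP x).
Qed.

HB.instance Definition _ := Choice.copy detRing (int * Cstar)%type.
HB.instance Definition _ :=
  GRing.isZmodule.Build detRing detRing_addA detRing_addC detRing_add0
    detRing_addN.

Fact detRing_mulA : associative detRing_mul.
Proof.
move=> [a x] [b y] [c z]; congr (_, _) => /=; first by rewrite mulrA.
apply: val_inj => /=.
rewrite !exprzMl ?unitfE ?expfz_neq0 ?(valP x) ?(valP y) ?(valP z) //.
by rewrite !exprz_exp mulrA [(c * a)%R]mulrC [(b * a)%R]mulrC.
Qed.
Fact detRing_mulC : commutative detRing_mul.
Proof.
move=> [a x] [b y]; congr (_, _) => /=; first by rewrite mulrC.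
by apply: val_inj; rewrite /= mulrC.
Qed.
Fact detRing_mul1 : left_id ((1, cstar1) : detRing) detRing_mul.
Proof.
move=> [a x]; rewrite /detRing_mul /= mul1r; congr (_, _).
by apply: val_inj; rewrite /= exp1rz mul1r expr1z.
Qed.
Fact detRing_mulD : left_distributive detRing_mul detRing_add.
Proof.
move=> [a x] [b y] [c z]; congr (_, _) => /=; first by rewrite mulrDl.
apply: val_inj => /=.
rewrite exprzMl ?unitfE ?(valP x) ?(valP y) // expfzDr ?(valP z) //.
by rewrite mulrACA.
Qed.
Fact detRing_10 : ((1, cstar1) : detRing) != 0.
Proof. by apply/eqP => /(congr1 fst). Qed.

HB.instance Definition _ :=
  GRing.Zmodule_isComNzRing.Build detRing detRing_mulA detRing_mulC
    detRing_mul1 detRing_mulD detRing_10.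

End Cstar.

Section V.
Variable R : realType.
Local Notation C := R[i].

(* Objects C^p are represented by p.  A morphism C^p -> C^q exists only if
   p = q; it is an automorphism of C^p, acting on column vectors. *)
Record iso (p q : nat) := Iso {
  iso_eq : p = q ;
  iso_aut : 'M[C]_p ;
  iso_unit : iso_aut \in unitmx
}.

Definition iso_mx p q (f : iso p q) : 'M[C]_(q, p) :=
  castmx (iso_eq f, erefl p) (iso_aut f).

Fact iso_det_subproof p q (f : iso p q) : \det (iso_aut f) != 0.
Proof. by have := iso_unit f; rewrite unitmxE unitfE. Qed.
Definition iso_det p q (f : iso p q) : Cstar R :=
  exist _ (\det (iso_aut f)) (iso_det_subproof f).

Definition iso_id p : iso p p := Iso (erefl p) (unitmx1 C p).

Fact iso_comp_subproof p q r (g : iso q r) (f : iso p q) :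
  castmx (esym (iso_eq f), esym (iso_eq f)) (iso_aut g) *m iso_aut f
    \in unitmx.
Proof.
case: f => e A uA; case: q / e g => g /=.
by rewrite castmx_id unitmx_mul iso_unit.
Qed.
Definition iso_comp p q r (g : iso q r) (f : iso p q) : iso p r :=
  Iso (etrans (iso_eq f) (iso_eq g)) (iso_comp_subproof g f).

Lemma tens11 p q : (1%:M : 'M[C]_p) *t (1%:M : 'M[C]_q) = 1%:M.
Proof.
apply/matrixP => i j.
case: (mxtens_indexP i) => i1 i2; case: (mxtens_indexP j) => j1 j2.
rewrite tensmxE !mxE -natrM mulnb; congr (_%:R); congr nat_of_bool.
apply/andP/eqP => [[/eqP -> /eqP ->]//|].
by move/(congr1 (@mxtens_unindex p q)); rewrite !mxtens_indexK => -[-> ->].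
Qed.

Lemma tens_unitmx p q (A : 'M[C]_p) (B : 'M[C]_q) :
  A \in unitmx -> B \in unitmx -> A *t B \in unitmx.
Proof.
move=> uA uB.
suff /mulmx1_unit[] : (invmx A *t invmx B) *m (A *t B) = 1%:M by [].
by rewrite tensmx_mul !mulVmx // tens11.
Qed.

Lemma mxdiag_unitmx n (p : 'I_n -> nat) (A : forall j, 'M[C]_(p j)) :
  (forall j, A j \in unitmx) -> \mxdiag_j A j \in unitmx.
Proof.
move=> uA.
suff /mulmx1_unit[] : (\mxdiag_j A j) *m (\mxdiag_j invmx (A j)) = 1%:M by [].
rewrite -mxdiagZ [X in X *m _]/mxdiag mul_mxblock_mxdiag /mxdiag; apply/eq_mxblock => i j.
case: eqVneq => [e|_]; last by rewrite mul0mx.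
by case: j / e; rewrite !conform_mx_id mulmxV.
Qed.

Variable n : nat.

Definition mob := 'I_n -> 'I_n -> nat.

(* Bases of direct sums and tensor products are ordered lexicographically;
   this is the ordering built into \mxdiag and *t. *)
Definition mob_mul (E F : mob) : mob :=
  fun i k => (\sum_(j < n) E i j * F j k)%N.

Definition mmor (E F : mob) := forall i j, iso (E i j) (F i j).

Definition mmor_id (E : mob) : mmor E E := fun i j => iso_id (E i j).

Definition mmor_comp (E F G : mob) (g : mmor F G) (f : mmor E F) : mmor E G :=
  fun i j => iso_comp (g i j) (f i j).

Fact mmor_mul_eq (E E' F F' : mob) (f : mmor E E') (g : mmor F F') i k :
  mob_mul E F i k = mob_mul E' F' i k.
Proof. by apply: eq_bigr => j _; rewrite (iso_eq (f i j)) (iso_eq (g j k)). Qed.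
Fact mmor_mul_unit (E E' F F' : mob) (f : mmor E E') (g : mmor F F') i k :
  \mxdiag_j (iso_aut (f i j) *t iso_aut (g j k)) \in unitmx.
Proof. by apply: mxdiag_unitmx => j; apply: tens_unitmx; exact: iso_unit. Qed.
Definition mmor_mul (E E' F F' : mob) (f : mmor E E') (g : mmor F F') :
    mmor (mob_mul E F) (mob_mul E' F') :=
  fun i k => Iso (mmor_mul_eq f g i k) (mmor_mul_unit f g i k).

Fact mob_mulA (E F G : mob) i l :
  mob_mul E (mob_mul F G) i l = mob_mul (mob_mul E F) G i l.
Proof.
rewrite /mob_mul; under eq_bigr do rewrite big_distrr /=.
rewrite exchange_big /=; apply: eq_bigr => k _.
by rewrite big_distrl /=; apply: eq_bigr => j _; rewrite mulnA.
Qed.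

(* The coherence isomorphism (E(FG))_il -> ((EF)G)_il sends the basis vector
   e (x) (f (x) g) of E_ij (x) (F_jk (x) G_kl) to (e (x) f) (x) g. *)
Section Associator.
Variables (E F G : mob) (i l : 'I_n).

Definition reassoc (b : 'I_(mob_mul E (mob_mul F G) i l)) :
    'I_(mob_mul (mob_mul E F) G i l) :=
  let: existT j ew := tagnat.sig b in
  let: (e, w) := @mxtens_unindex _ _ ew in
  let: existT k fg := tagnat.sig w in
  let: (f, g) := @mxtens_unindex _ _ fg in
  tagnat.Rank (p_ := fun k => (mob_mul E F i k * G k l)%N) k
    (@mxtens_index _ _
       (tagnat.Rank (p_ := fun j => (E i j * F j k)%N) j (@mxtens_index _ _ (e, f)),
        g)).

Definition reassoc_sq (b : 'I_(mob_mul E (mob_mul F G) i l)) :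
    'I_(mob_mul E (mob_mul F G) i l) :=
  cast_ord (esym (mob_mulA E F G i l)) (reassoc b).

Lemma reassoc_inj : injective reassoc.
Proof.
move=> b b'; rewrite /reassoc => eqb.
rewrite -[b]tagnat.sigK -[b']tagnat.sigK; congr (tagnat.rank _); move: eqb.
case: (tagnat.sig b) (tagnat.sig b') => j ew [j' ew'] /=.
case: (mxtens_indexP ew) => e w; case: (mxtens_indexP ew') => e' w' /=.
have := @mxtens_indexK _ _ (e, w); have := @mxtens_indexK _ _ (e', w').
rewrite /mxtens_unindex => -[-> ->] [-> ->].
rewrite -[w]tagnat.sigK -[w']tagnat.sigK !tagnat.rankK.
case: (tagnat.sig w) (tagnat.sig w') => k fg [k' fg'] /=.
case: (mxtens_indexP fg) => f g; case: (mxtens_indexP fg') => f' g' /=.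
have := @mxtens_indexK _ _ (f, g); have := @mxtens_indexK _ _ (f', g').
rewrite /mxtens_unindex => -[-> ->] [-> ->].
move/tagnat.rank_inj => eq1; have ek := congr1 tag eq1; rewrite /= in ek.
case: _ / ek in fg' f' g' eq1 *; move/eqP: eq1; rewrite eq_Tagged /= => /eqP.
move=> /(congr1 (@mxtens_unindex _ _)); rewrite !mxtens_indexK => eqp.
have /= -> := congr1 snd eqp; have /= eq2 := congr1 fst eqp.
have {}eq2 := tagnat.rank_inj eq2; have ej := congr1 tag eq2; rewrite /= in ej.
case: _ / ej in e' f' eqp eq2 *; move/eqP: eq2; rewrite eq_Tagged /= => /eqP.
by move=> /(congr1 (@mxtens_unindex _ _)); rewrite !mxtens_indexK => -[-> ->].
Qed.

Lemma reassoc_sq_inj : injective reassoc_sq.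
Proof. by move=> b b' /cast_ord_inj/reassoc_inj. Qed.

Definition assoc_mx : 'M[C]_(mob_mul E (mob_mul F G) i l) :=
  \matrix_(a, b) (a == reassoc_sq b)%:R.

Fact assoc_unit : assoc_mx \in unitmx.
Proof.
suff -> : assoc_mx = (perm_mx (perm reassoc_sq_inj))^T.
  by rewrite unitmx_tr unitmx_perm.
by apply/matrixP => a b; rewrite !mxE permE eq_sym.
Qed.

End Associator.

Definition massoc (E F G : mob) :
    mmor (mob_mul E (mob_mul F G)) (mob_mul (mob_mul E F) G) :=
  fun i l => Iso (mob_mulA E F G i l) (assoc_unit E F G i l).

Definition mob_det (E : mob) : int := \det (\matrix_(i, j) (E i j)%:Z).

Definition Det (E F : mob) (f : mmor E F) : detRing R :=
  \det (\matrix_(i, j) (((E i j)%:Z, iso_det (f i j)) : detRing R)).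

Record glob := GlOb {
  glob_mob :> mob ;
  glob_det : (mob_det glob_mob == 1) || (mob_det glob_mob == -1)
}.

Fact glob_mul_subproof (E F : glob) :
  (mob_det (mob_mul E F) == 1) || (mob_det (mob_mul E F) == -1).
Proof.
have -> : mob_det (mob_mul E F) = mob_det E * mob_det F.
  rewrite /mob_det -det_mulmx; congr (\det _); apply/matrixP => i k.
  rewrite !mxE (big_morph Posz PoszD (erefl 0)); apply: eq_bigr => j _.
  by rewrite !mxE PoszM.
by case/orP: (glob_det E) => /eqP ->; case/orP: (glob_det F) => /eqP ->.
Qed.
Definition glob_mul (E F : glob) : glob := GlOb (glob_mul_subproof E F).

(* The sign of an associator c, where Det(c) = (+-1, s) with s in {1,-1}. *)
Definition sgn (E F : glob) (c : mmor E F) : bool := val (Det c).2 == -1.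

(* Dger(f, s) = (s a)^d where Det(f) = (d, a). *)
Definition Dger (E F : glob) (fs : mmor E F * bool) : Cstar R :=
  cstar_exp (cstar_mul (cstar_sign R fs.2) (Det fs.1).2) (Det fs.1).1.

End V.

(* The data of a smooth monoidal category with discrete objects that enters
   the definition of a principal bundle: [smooth_mor W g] says that g
   restricts to a smooth map W -> mor X Y. *)
Record smoothMonCat (R : realType) (m : nat) (M : smoothManifold R m) :=
  SmoothMonCat {
  ob : Type ;
  mor : ob -> ob -> Type ;
  idm : forall X, mor X X ;
  comp : forall X Y Z, mor Y Z -> mor X Y -> mor X Z ;
  obM : ob -> ob -> ob ;
  morM : forall X X' Y Y', mor X X' -> mor Y Y' -> mor (obM X Y) (obM X' Y') ;
  assoc : forall X Y Z, mor (obM X (obM Y Z)) (obM (obM X Y) Z) ;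
  smooth_mor : forall X Y, set M -> (M -> mor X Y) -> Prop
}.

Section Instances.
Variables (R : realType) (m : nat) (M : smoothManifold R m).

(* The {1,-1}-component of a smooth map is locally constant. *)
Definition OGl (n : nat) : smoothMonCat M :=
  @SmoothMonCat R m M (glob n) (fun E F => (mmor R E F * bool)%type)
    (fun E => (mmor_id R E, false))
    (fun E F G g f => (mmor_comp g.1 f.1, g.2 (+) f.2))
    (@glob_mul n)
    (fun E E' F F' f g => (mmor_mul f.1 g.1, f.2 (+) g.2))
    (fun E F G => (massoc R E F G,
       @sgn R n (glob_mul E (glob_mul F G)) (glob_mul (glob_mul E F) G)
         (massoc R E F G)))
    (fun E F W g =>
       (forall i j, smooth_mx W (fun x => iso_aut ((g x).1 i j))) /\
       (forall x, W x -> \forall y \near x, W y -> (g y).2 = (g x).2)).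

Definition Lplus : smoothMonCat M :=
  @SmoothMonCat R m M unit (fun _ _ => Cstar R)
    (fun _ => cstar1 R)
    (fun _ _ _ => @cstar_mul R)
    (fun _ _ => tt)
    (fun _ _ _ _ => @cstar_mul R)
    (fun _ _ _ => cstar1 R)
    (fun _ _ W g => smoothC W (fun x => val (g x))).

End Instances.

Section Bundles.
Variables (R : realType) (m : nat) (M : smoothManifold R m).
Variables (d : Order.disp_t) (J : porderType d).

Definition ordered_open_cover (U : J -> set M) : Prop :=
  open_cover U /\
  (forall s : seq J, (exists x, forall a, a \in s -> U a x) ->
     {in s &, forall a b, (a <= b)%O || (b <= a)%O}).

(* Objects and coherency maps; values [bundle_ob a b] with not a < b are
   irrelevant. *)
Record bundleData (B : smoothMonCat M) := BundleData {
  bundle_ob : J -> J -> ob B ;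
  bundle_mor : forall a b c, (a < b)%O -> (b < c)%O -> M ->
    mor (obM (bundle_ob a b) (bundle_ob b c)) (bundle_ob a c)
}.

Definition is_bundle (B : smoothMonCat M) (U : J -> set M) (E : bundleData B) :
    Prop :=
  [/\ ordered_open_cover U,
      forall a b c, (a < b)%O -> (b < c)%O ->
        obM (bundle_ob E a b) (bundle_ob E b c) = bundle_ob E a c,
      forall a b c (ab : (a < b)%O) (bc : (b < c)%O),
        smooth_mor (U a `&` U b `&` U c) (bundle_mor E ab bc) &
      forall a b c e (ab : (a < b)%O) (bc : (b < c)%O) (ce : (c < e)%O) x,
        (U a `&` U b `&` U c `&` U e) x ->
        comp (bundle_mor E ab (lt_trans bc ce) x)
             (morM (idm (bundle_ob E a b)) (bundle_mor E bc ce x)) =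
        comp (bundle_mor E (lt_trans ab bc) ce x)
             (comp (morM (bundle_mor E ab bc x) (idm (bundle_ob E c e)))
                   (assoc (bundle_ob E a b) (bundle_ob E b c)
                          (bundle_ob E c e)))].

Definition Dger_bundle n (E : bundleData (OGl M n)) : bundleData (Lplus M) :=
  @BundleData (Lplus M) (fun _ _ => tt)
    (fun a b c ab bc x => Dger (bundle_mor E ab bc x)).

Definition mconn n (E : mob n) := forall i j, conn M (E i j).

Definition mconn_mul n (E F : mob n) (A : mconn E) (B : mconn F) :
    mconn (mob_mul E F) :=
  fun i k => sum_conn (fun j => tensor_conn (A i j) (B j k)).

Definition is_connective n (U : J -> set M) (E : bundleData (OGl M n))
    (A : forall a b, mconn (bundle_ob E a b)) : Prop :=
  (forall a b, (a < b)%O -> forall i j, is_connection (U a `&` U b) (A a b i j))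
  /\
  (forall a b c (ab : (a < b)%O) (bc : (b < c)%O) i k,
     pullback_conn_eq (U a `&` U b `&` U c)
       (fun x => iso_mx ((bundle_mor E ab bc x).1 i k))
       (A a c i k) (mconn_mul (A a b) (A b c) i k)).

(* Connections on line bundles are connections on W x C^1; C^1 (x) C^1 is
   C^(1 * 1), and 1 * 1 is convertible to 1. *)
Definition is_gerbe_connective (U : J -> set M) (g : bundleData (Lplus M))
    (D : J -> J -> conn M 1) : Prop :=
  (forall a b, (a < b)%O -> is_connection (U a `&` U b) (D a b)) /\
  (forall a b c (ab : (a < b)%O) (bc : (b < c)%O),
     pullback_conn_eq (U a `&` U b `&` U c)
       (fun x => (val (bundle_mor g ab bc x))%:M)
       (D a c) (tensor_conn (D a b) (D b c))).

(* [D] has parallel transport Dger(P_f) along every path f in W, where P_f is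
   the parallel transport of A, taken with sign +1. *)
Definition Dger_transport n (E : glob n) (W : set M) (A : mconn E)
    (D : conn M 1) : Prop :=
  forall (f : R -> M) (P : mmor R E E), smooth_path W f ->
    (forall i j, transport (A i j) f (iso_aut (P i j))) ->
    transport D f (val (Dger (P, false)))%:M.

End Bundles.

(* Main.v *)
Require Import Defs.
From HB Require Import structures.
From mathcomp Require Import all_boot all_order all_algebra.
From mathcomp Require Import mathcomp_extra boolp classical_sets functions.
From mathcomp Require Import set_interval constructive_ereal ereal.
From mathcomp Require Import reals topology normedtype derive realfun sequences exp.
From mathcomp Require Import measure lebesgue_measure lebesgue_integral ftc.
From mathcomp Require Import perm complex mxtens.
From mathcomp Require Import ring lra.
(* [coord] denotes the chart of a manifold, not coordinates in a basis. *)
Import Defs.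

Set Implicit Arguments.
Unset Strict Implicit.
Unset Printing Implicit Defensive.

Import Order.TTheory GRing.Theory Num.Theory.
Import numFieldNormedType.Exports.

Local Open Scope classical_set_scope.
Local Open Scope ring_scope.
Local Open Scope complex_scope.

(** Write N = (dim E_ij) for an object E of Gl_n(V); it is invertible over Z.  The
    ring R = Z x C^* is a square-zero extension of Z, so the determinant over R
    expands to first order:
      Det(f) = (det N, prod_ij det(f_ij)^(cof_ij N)).
    With det N = 1 or -1 this gives Dger(f, s) = s prod_ij det(f_ij)^(K_ij), where
    the matrix of exponents K is the transpose of N^-1 ([DgerE]).

    Since (N_E N_F)^-1 = N_F^-1 N_E^-1, the exponents of a product pair with
    a_ij F_jk + b_jk E_ij as the exponents of the factors do with a and b
    ([dger_exp_pairing]).  In multiplicative notation, a and b being the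
    determinants of f and g, this says that Dger is multiplicative
    ([Dger_mul]); the sign attached to an associator is chosen to make its Dger
    equal to 1 ([Dger_assoc]), and the 2-cocycle identity follows
    ([Dger_cocycle]).  In additive notation, with traces of connection forms in
    place of determinants, it says that the connections
      D = d + sum_ij K_ij tr(A_ij)     ([dger_conn])
    are compatible with products.

    D has the required parallel transport: if T is a solution of the transport
    equation T' = - A(f') T then det T satisfies (det T)' = - tr A(f') det T
    ([flow_det]), and it never vanishes because the zero set of a solution of a
    scalar linear equation is open and closed ([linear_ode_neq0]); so
    prod det(T_ij)^(K_ij) solves the transport equation of D
    ([dger_conn_transport]).

    Conversely a connection is determined by these transports
    ([dger_conn_unique]).  This needs the transports of the A_ij to exist, which
    Picard iteration provides ([linear_ode_exists]).  Coordinate lines through a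
    point suffice, and shortening them recovers the whole solution, hence its
    logarithmic derivative, from its endpoints.

    Finally, evaluating the compatibility of phi with the connections on constant
    sections gives d phi = phi (A^ab A^bc) - A^ac phi, so that
    d log det phi_ik = tr (A^ab A^bc)_ik - tr A^ac_ik ([coherency_logd]).  Weighting
    by K_ik and summing yields d log Dger(phi) = D^ab + D^bc - D^ac
    ([Dger_logd]), the sign being locally constant; this is compatibility of the
    connections D with the 2-cocycle ([pullback_conn_logd]). *)

(** * Determinants of block diagonal matrices and tensor products *)

Section Determinants.
Variable K : comNzRingType.

Lemma det_castmx p q (e e' : p = q) (A : 'M[K]_p) :
  \det (castmx (e, e') A) = \det A.
Proof. by case: q / e e' => e'; rewrite castmx_id. Qed.

Lemma det_mx0 p (A : 'M[K]_p) : p = 0 -> \det A = 1.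
Proof. by move=> p0; case: _ / (esym p0) A => A; exact: det_mx00. Qed.

Lemma det_mxdiag n (p : 'I_n -> nat) (A : forall j, 'M[K]_(p j)) :
  \det (\mxdiag_j A j) = \prod_j \det (A j).
Proof.
elim: n p A => [|n IHn] p A.
  by rewrite det_mx0 !big_ord0.
by rewrite mxdiag_recl det_castmx det_lblock IHn big_ord_recl.
Qed.

Lemma det_tens1mx p q (B : 'M[K]_q) :
  \det ((1%:M : 'M[K]_p) *t B) = \det B ^+ p.
Proof.
elim: p => [|p IHp]; first by rewrite expr0 det_mx00.
rewrite exprS -IHp -[p.+1]/(1 + p)%N scalar_mx_block.
rewrite tens_block_mx det_castmx !tens0mx det_ublock; congr (_ * _).
by rewrite [1%:M]/(1 : 'M_1) tens_scalar1mx det_castmx.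
Qed.

(** Exchanging the factors of a tensor product is such a bijection, between the
    index sets of sizes p * q and q * p. *)
Lemma det_reindex p q (h : 'I_p -> 'I_q) (g : 'I_q -> 'I_p) (A : 'M[K]_q) :
  cancel h g -> cancel g h -> \det (\matrix_(i, j) A (h i) (h j)) = \det A.
Proof.
move=> hK gK; have e : p = q.
  by have := bij_eq_card (Bijective hK gK); rewrite !card_ord.
case: q / e h g A hK gK => h g A hK _.
suff -> : \matrix_(i, j) A (h i) (h j) =
    row_perm (perm (can_inj hK)) (col_perm (perm (can_inj hK)) A).
  rewrite row_permE col_permE !det_mulmx !det_perm mulrCA odd_permV.
  by rewrite -signr_addb addbb mulr1.
by apply/matrixP => i j; rewrite !mxE !permE.
Qed.

Lemma det_tensmx1 p q (A : 'M[K]_p) :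
  \det (A *t (1%:M : 'M[K]_q)) = \det A ^+ q.
Proof.
rewrite -det_tens1mx.
pose swap a b (k : 'I_(a * b)) : 'I_(b * a) :=
  @mxtens_index b a ((@mxtens_unindex a b k).2, (@mxtens_unindex a b k).1).
have swapK a b : cancel (@swap a b) (@swap b a).
  by move=> k; rewrite /swap !mxtens_indexK; exact: mxtens_unindexK.
rewrite -(det_reindex (1%:M *t A) (swapK p q) (swapK q p)).
congr (\det _); apply/matrixP => i j.
by rewrite !mxE /swap !mxtens_indexK mulrC.
Qed.

Lemma det_tens p q (A : 'M[K]_p) (B : 'M[K]_q) :
  \det (A *t B) = \det A ^+ q * \det B ^+ p.
Proof. by rewrite tensmx_decr det_mulmx det_tensmx1 det_tens1mx. Qed.

Lemma mxtrace_tens p q (A : 'M[K]_p) (B : 'M[K]_q) :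
  \tr (A *t B) = \tr A * \tr B.
Proof.
rewrite /mxtrace big_distrlr /= pair_bigA /=.
rewrite (reindex (@mxtens_index p q)); last first.
  by exists (@mxtens_unindex p q) => ? _; rewrite (mxtens_indexK, mxtens_unindexK).
by apply: eq_bigr => -[i j] _; rewrite tensmxE.
Qed.

End Determinants.

(** * The determinant over R = Z x C^* *)

Section IntegerPowers.
Variable F : fieldType.

Lemma expfz_prod (I : Type) (r : seq I) (P : pred I) (f : I -> F) (k : int) :
  (\prod_(i <- r | P i) f i) ^ k = \prod_(i <- r | P i) f i ^ k.
Proof.
by apply: (big_morph (fun z => z ^ k)) => [a b|]; rewrite ?exp1rz ?expfzMl.
Qed.

Lemma expfz_sum (I : Type) (r : seq I) (P : pred I) (a : F) (k : I -> int) :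
  a != 0 -> a ^ (\sum_(i <- r | P i) k i) = \prod_(i <- r | P i) a ^ k i.
Proof.
by move=> a0; apply: (big_morph (fun z => a ^ z)) => // x y; rewrite expfzDr.
Qed.

End IntegerPowers.

Section DetRing.
Variable R : realType.
Local Notation C := R[i].
Implicit Types x y : detRing R.

Lemma detRing_sum1 (I : Type) (r : seq I) (P : pred I) (F : I -> detRing R) :
  (\sum_(i <- r | P i) F i).1 = \sum_(i <- r | P i) (F i).1.
Proof. exact: (big_morph fst). Qed.

Lemma detRing_sum2 (I : Type) (r : seq I) (P : pred I) (F : I -> detRing R) :
  val (\sum_(i <- r | P i) F i).2 = \prod_(i <- r | P i) val (F i).2.
Proof. exact: (big_morph (fun x : detRing R => val x.2)). Qed.

Lemma detRing_prod1 (I : Type) (r : seq I) (P : pred I) (F : I -> detRing R) :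
  (\prod_(i <- r | P i) F i).1 = \prod_(i <- r | P i) (F i).1.
Proof. exact: (big_morph fst). Qed.

(** The derivative of a product, the second component being the infinitesimal
    part written multiplicatively. *)
Lemma detRing_prod2 (I : eqType) (r : seq I) (F : I -> detRing R) : uniq r ->
  val (\prod_(i <- r) F i).2 =
    \prod_(i <- r) val (F i).2 ^ (\prod_(k <- r | i != k) (F k).1).
Proof.
elim: r => [|i r IHr]; first by rewrite !big_nil.
move=> /= /andP[ir /IHr {}IHr]; rewrite !big_cons /= eqxx /= IHr detRing_prod1.
congr (_ ^ _ * _).
  rewrite big_seq [RHS]big_seq_cond; apply: eq_bigl => k.
  by case: (boolP (k \in r)) => //= kr; case: eqVneq kr ir => //= -> ->.
rewrite expfz_prod; apply: eq_big_seq => j jr; rewrite big_cons.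
have -> : j != i by apply: contraNneq ir => <-.
by rewrite exprz_exp mulrC.
Qed.

Lemma detRing_sign (s : bool) x : ((-1) ^+ s * x).1 = (-1) ^+ s * x.1 /\
  val ((-1) ^+ s * x).2 = val x.2 ^ ((-1) ^+ s : int).
Proof.
case: s; rewrite ?expr0 ?mul1r ?expr1z // expr1 !mulN1r.
by split.
Qed.

(** Collect the factors of Leibniz' formula at the entry (i, j): the permutations
    that send i to j make up the cofactor. *)
Lemma det_detRing n (A : 'M[detRing R]_n) (N := map_mx fst A) :
  (\det A).1 = \det N /\
  val (\det A).2 = \prod_i \prod_j val (A i j).2 ^ cofactor N i j.
Proof.
split.
  rewrite /determinant detRing_sum1; apply: eq_bigr => s _.
  rewrite (detRing_sign s _).1 detRing_prod1; congr (_ * _).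
  by apply: eq_bigr => i _; rewrite mxE.
rewrite /determinant detRing_sum2.
under eq_bigr => s _.
  rewrite (detRing_sign s _).2 detRing_prod2; last exact: index_enum_uniq.
  rewrite expfz_prod; over.
rewrite exchange_big /=; apply: eq_bigr => i _.
rewrite (partition_big (fun s : 'S_n => s i) xpredT) //=; apply: eq_bigr => j _.
rewrite expand_cofactor expfz_sum ?(valP (A i j).2) //.
apply: eq_bigr => s /eqP <-; rewrite exprz_exp mulrC; congr (_ ^ (_ * _)).
by apply: eq_bigr => k _; rewrite mxE.
Qed.

End DetRing.

Section DetFormula.
Variables (R : realType) (n : nat).
Local Notation C := R[i].
Implicit Types E F : glob n.

Definition dim_mx (E : mob n) : 'M[int]_n := \matrix_(i, j) (E i j)%:Z.

(** The transpose of the inverse of [dim_mx E], for objects of Gl_n(V). *)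
Definition dger_exp (E : mob n) (i j : 'I_n) : int :=
  mob_det E * cofactor (dim_mx E) i j.

Lemma mob_det_sq E : mob_det E * mob_det E = 1.
Proof. by case/orP: (glob_det E) => /eqP ->. Qed.

Lemma DetE (E F : mob n) (f : mmor R E F) : (Det f).1 = mob_det E /\
  val (Det f).2 =
    \prod_i \prod_j \det (iso_aut (f i j)) ^ cofactor (dim_mx E) i j.
Proof.
rewrite /Det; set A := \matrix_(i, j) _.
have -> : dim_mx E = map_mx fst A by apply/matrixP => i j; rewrite !mxE.
have [-> ->] := det_detRing A; split.
  by congr (\det _); apply/matrixP => i j; rewrite !mxE.
by apply: eq_bigr => i _; apply: eq_bigr => j _; rewrite mxE.
Qed.

Lemma DgerE E F (f : mmor R E F) s : val (Dger (f, s)) =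
  (-1) ^+ s * \prod_i \prod_j \det (iso_aut (f i j)) ^ dger_exp E i j.
Proof.
rewrite /= (DetE f).1 (DetE f).2 expfzMl; congr (_ * _).
  by case/orP: (glob_det E) => /eqP ->; rewrite ?expr1z // exprN1 invr_sign.
rewrite expfz_prod; apply: eq_bigr => i _.
rewrite expfz_prod; apply: eq_bigr => j _.
by rewrite exprz_exp mulrC.
Qed.

Lemma dim_mx_mul E F : dim_mx (mob_mul E F) = dim_mx E *m dim_mx F.
Proof.
apply/matrixP => i k; rewrite !mxE (big_morph Posz PoszD (erefl 0)).
by apply: eq_bigr => j _; rewrite !mxE PoszM.
Qed.

Definition dger_mx (E : mob n) : 'M[int]_n := \matrix_(i, j) dger_exp E j i.

Lemma dger_mxE (E : mob n) : dger_mx E = mob_det E *: \adj (dim_mx E).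
Proof. by apply/matrixP => i j; rewrite !mxE. Qed.

Lemma dim_mulV E : dim_mx E *m dger_mx E = 1%:M.
Proof.
by rewrite dger_mxE -scalemxAr mul_mx_adj scale_scalar_mx mob_det_sq.
Qed.

Lemma dim_mulVl E : dger_mx E *m dim_mx E = 1%:M.
Proof.
by rewrite dger_mxE -scalemxAl mul_adj_mx scale_scalar_mx mob_det_sq.
Qed.

Lemma dger_exp_mull E F i j :
  \sum_k (glob_mob F j k)%:Z * dger_exp (mob_mul E F) i k = dger_exp E i j.
Proof.
transitivity ((dim_mx F *m dger_mx (glob_mul E F)) j i).
  by rewrite mxE; apply: eq_bigr => k _; rewrite !mxE.
have <- : dger_mx E j i = dger_exp E i j by rewrite mxE.
congr (fun_of_matrix _ j i).
rewrite -[LHS]mul1mx -(dim_mulVl E) -mulmxA [dim_mx E *m _]mulmxA.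
by rewrite -dim_mx_mul (dim_mulV (glob_mul E F)) mulmx1.
Qed.

Lemma dger_exp_mulr E F j k :
  \sum_i (glob_mob E i j)%:Z * dger_exp (mob_mul E F) i k = dger_exp F j k.
Proof.
transitivity ((dger_mx (glob_mul E F) *m dim_mx E) k j).
  by rewrite mxE; apply: eq_bigr => i _; rewrite !mxE mulrC.
have <- : dger_mx F k j = dger_exp F j k by rewrite mxE.
congr (fun_of_matrix _ k j).
rewrite -[LHS]mulmx1 -(dim_mulV F) mulmxA -[_ *m dim_mx E *m _]mulmxA.
by rewrite -dim_mx_mul (dim_mulVl (glob_mul E F)) mul1mx.
Qed.

(** Both the multiplicativity of Dger (with V = [detRing R], whose addition
    multiplies second components) and the additivity of the induced connection
    forms (with V the complex numbers) are instances. *)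
Lemma dger_exp_pairing (V : zmodType) E F (a b : 'I_n -> 'I_n -> V) :
  \sum_i \sum_k
     (\sum_j (a i j *+ glob_mob F j k + b j k *+ glob_mob E i j)) *~ dger_exp (mob_mul E F) i k =
  \sum_i \sum_j a i j *~ dger_exp E i j + \sum_j \sum_k b j k *~ dger_exp F j k.
Proof.
transitivity (\sum_i \sum_k (\sum_j a i j *~ ((glob_mob F j k)%:Z * dger_exp (mob_mul E F) i k)
    + \sum_j b j k *~ ((glob_mob E i j)%:Z * dger_exp (mob_mul E F) i k))).
  apply: eq_bigr => i _; apply: eq_bigr => k _.
  rewrite -big_split /= mulrz_suml; apply: eq_bigr => j _.
  by rewrite mulrzDl !mulrzA.
under eq_bigr do rewrite big_split /=.
rewrite big_split /=; congr (_ + _).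
  apply: eq_bigr => i _; rewrite exchange_big /=; apply: eq_bigr => j _.
  by rewrite -mulrz_sumr dger_exp_mull.
under eq_bigr do rewrite exchange_big /=.
rewrite exchange_big /=; apply: eq_bigr => j _.
rewrite exchange_big /=; apply: eq_bigr => k _.
by rewrite -mulrz_sumr dger_exp_mulr.
Qed.

End DetFormula.

(** * Functoriality of Dger *)

Section DgerFunctor.
Variables (R : realType) (n : nat).
Implicit Types E F G : glob n.

Definition detRing_eps (a : Cstar R) : detRing R := (0, a).

Lemma detRing_add2 (x y : detRing R) : val (x + y).2 = val x.2 * val y.2.
Proof. by []. Qed.

Lemma detRing_mulrn2 (x : detRing R) k : val (x *+ k).2 = val x.2 ^+ k.
Proof. by elim: k => // k IHk; rewrite mulrS exprS detRing_add2 IHk. Qed.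

Lemma detRing_mulrz2 (x : detRing R) k : val (x *~ k).2 = val x.2 ^ k.
Proof.
case: k => k; first by rewrite -pmulrn detRing_mulrn2.
by rewrite NegzE mulrNz -exprnN -detRing_mulrn2.
Qed.

Lemma val_cstar_mul (a b : Cstar R) : val (cstar_mul a b) = val a * val b.
Proof. by []. Qed.

Lemma det_iso_comp p q r (g : iso R q r) (f : iso R p q) :
  \det (iso_aut (iso_comp g f)) = \det (iso_aut g) * \det (iso_aut f).
Proof. by rewrite /= det_mulmx det_castmx. Qed.

Lemma Dger_comp E F G (g : mmor R F G) (f : mmor R E F) s t :
  Dger (mmor_comp g f, s (+) t) = cstar_mul (Dger (g, s)) (Dger (f, t)).
Proof.
apply: val_inj; rewrite val_cstar_mul !DgerE signr_addb mulrACA; congr (_ * _).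
have eK : dger_exp F = dger_exp E.
  by congr dger_exp; apply/funext => i; apply/funext => j; rewrite (iso_eq (f i j)).
rewrite -big_split; apply: eq_bigr => i _.
rewrite -big_split; apply: eq_bigr => j _.
by rewrite det_iso_comp expfzMl eK.
Qed.

Lemma Dger_id E : Dger (mmor_id R E, false) = cstar1 R.
Proof.
apply: val_inj; rewrite DgerE mul1r /= big1 // => i _.
by rewrite big1 // => j _; rewrite det1 exp1rz.
Qed.

Lemma Dger_mul E E' F F' (f : mmor R E E') (g : mmor R F F') s t :
  @Dger R n (glob_mul E F) (glob_mul E' F') (mmor_mul f g, s (+) t) =
  cstar_mul (Dger (f, s)) (Dger (g, t)).
Proof.
apply: val_inj; rewrite val_cstar_mul !DgerE signr_addb mulrACA; congr (_ * _).
pose eps p q (h : iso R p q) := detRing_eps (iso_det h).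
have := congr1 (fun x : detRing R => val x.2)
  (dger_exp_pairing E F (fun i j => eps _ _ (f i j)) (fun j k => eps _ _ (g j k))).
rewrite /= !detRing_sum2 => e; apply: etrans (etrans e _).
  apply: eq_bigr => i _; rewrite detRing_sum2; apply: eq_bigr => k _.
  rewrite mulrz_suml detRing_sum2 /= det_mxdiag expfz_prod; apply: eq_bigr => j _.
  rewrite det_tens -[RHS]/(val _) detRing_mulrz2 detRing_add2.
  by rewrite !detRing_mulrn2.
by congr (_ * _); apply: eq_bigr => i _; rewrite detRing_sum2;
   apply: eq_bigr => j _; rewrite detRing_mulrz2.
Qed.

(** The components of an associator are permutation matrices, so the second
    component of Det is a sign, and it cancels against the attached one. *)
Lemma Dger_assoc E F G :
  let c := massoc R E F G in
  @Dger R n (glob_mul E (glob_mul F G)) (glob_mul (glob_mul E F) G)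
    (c, @sgn R n (glob_mul E (glob_mul F G)) (glob_mul (glob_mul E F) G) c) =
  cstar1 R.
Proof.
move=> c.
have detc : (val (Det c).2 == 1) || (val (Det c).2 == -1).
  rewrite (DetE c).2; elim/big_ind: _ => [|x y|i _]; first by rewrite eqxx.
    by case/orP=> /eqP-> /orP[] /eqP->; rewrite ?mulrNN ?mulr1 ?mul1r eqxx ?orbT.
  elim/big_ind: _ => [|x y|l _]; first by rewrite eqxx.
    by case/orP=> /eqP-> /orP[] /eqP->; rewrite ?mulrNN ?mulr1 ?mul1r eqxx ?orbT.
  have -> : iso_aut (c i l) = (perm_mx (perm (@reassoc_sq_inj n E F G i l)))^T.
    by apply/matrixP => a b; rewrite !mxE permE eq_sym.
  rewrite det_tr det_perm; case: odd_perm; rewrite ?exp1rz ?eqxx //.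
  move: (cofactor _ i l) => k; rewrite expr1.
  by case: k => k; rewrite ?NegzE -?exprnN -?exprnP -signr_odd;
     case: odd; rewrite ?invrN ?invr1 eqxx ?orbT.
apply: val_inj; rewrite /= /sgn; case/orP: detc => /= /eqP ->.
  by rewrite eq_sym eqNr oner_eq0 mulr1 exp1rz.
by rewrite eqxx expr1 mulN1r opprK exp1rz.
Qed.

End DgerFunctor.

(** * Smooth functions *)

Section CkTheory.
Variables (R : realType) (V : normedModType R).
Implicit Types (W : set V) (f g : V -> R) (k : nat).

Lemma near_continuous (T : topologicalType) (f g : T -> R) (x : T) :
  (\forall y \near x, f y = g y) -> {for x, continuous f} -> {for x, continuous g}.
Proof.
move=> fg cf; rewrite /prop_for /continuous_at -(nbhs_singleton fg).
by apply: cvg_trans cf; apply: near_eq_cvg; apply: filterS fg => y ->.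
Qed.

Lemma near_open_eq W f g x : open W -> {in W, f =1 g} -> W x ->
  \forall y \near x, f y = g y.
Proof.
move=> oW fg Wx; have := open_nbhs_nbhs (conj oW Wx).
by apply: filterS => y Wy; apply: fg; rewrite inE.
Qed.

Lemma Ck_continuous k W f : Ck k W f -> forall x, W x -> {for x, continuous f}.
Proof. by case: k => [|k] []. Qed.

Lemma Ck_pred k W f : Ck k.+1 W f -> Ck k W f.
Proof.
elim: k f => [|k IHk] f [cf df]; first by [].
by split=> // v; have [dvf /IHk] := df v.
Qed.

(** Values of f off W enter neither continuity nor derivatives at points of W,
    because W is open. *)
Lemma Ck_ext k W f g : open W -> {in W, f =1 g} -> Ck k W f -> Ck k W g.
Proof.
move=> oW; elim: k f g => [|k IHk] f g fg Cf.
  split=> // x Wx; apply: near_continuous (near_open_eq oW fg Wx) _.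
  exact: Ck_continuous Cf x Wx.
split=> [x Wx|v].
  apply: near_continuous (near_open_eq oW fg Wx) _.
  exact: Ck_continuous Cf x Wx.
have [_ /(_ v) [dfv Cfv]] := Cf; split=> [x Wx|].
  exact: near_eq_derivable (near_open_eq oW fg Wx) (dfv x Wx).
apply: IHk Cfv => x; rewrite inE => Wx.
exact: near_eq_derive (near_open_eq oW fg Wx).
Qed.

Lemma Ck_cst k W (c : R) : Ck k W (cst c).
Proof.
elim: k c => [|k IHk] c; (split=> [x Wx|]; first exact: cst_continuous) => //.
move=> v; split=> [x _|]; first exact: derivable_cst.
by rewrite (_ : 'D_v _ = cst 0) //; apply/funext => x; rewrite derive_cst.
Qed.

Lemma CkD k W f g : open W -> Ck k W f -> Ck k W g -> Ck k W (f + g).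
Proof.
move=> oW; elim: k f g => [|k IHk] f g [cf Df] [cg Dg].
  by split=> // x Wx; apply: continuousD; [exact: cf|exact: cg].
split=> [x Wx|v]; first by apply: continuousD; [exact: cf|exact: cg].
have [df Cf] := Df v; have [dg Cg] := Dg v.
split=> [x Wx|]; first by apply: derivableD; [exact: df|exact: dg].
apply: Ck_ext (IHk _ _ Cf Cg) => // x; rewrite inE => Wx.
by rewrite deriveD //; [exact: df|exact: dg].
Qed.

Lemma CkM k W f g : open W -> Ck k W f -> Ck k W g -> Ck k W (f * g).
Proof.
move=> oW; elim: k f g => [|k IHk] f g Cf Cg.
  case: Cf Cg => cf _ [cg _].
  by split=> // x Wx; apply: continuousM; [exact: cf|exact: cg].
split=> [x Wx|v].
  by apply: continuousM; [exact: Ck_continuous Cf x Wx|exact: Ck_continuous Cg x Wx].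
have [_ /(_ v) [df Cf']] := Cf; have [_ /(_ v) [dg Cg']] := Cg.
split=> [x Wx|]; first by apply: derivableM; [exact: df|exact: dg].
apply: Ck_ext (CkD oW (IHk _ _ (Ck_pred Cf) Cg') (IHk _ _ (Ck_pred Cg) Cf')) => //.
by move=> x; rewrite inE => Wx; rewrite deriveM //; [exact: df|exact: dg].
Qed.

Lemma CkV k W f : open W -> (forall x, W x -> f x != 0) -> Ck k W f ->
  Ck k W (fun x => (f x)^-1).
Proof.
move=> oW f0; elim: k => [|k IHk] Cf.
  by case: Cf => cf _; split=> // x Wx; apply: cvgV; [exact: f0|exact: cf].
split=> [x Wx|v].
  by apply: cvgV; [exact: f0|exact: Ck_continuous Cf x Wx].
have [_ /(_ v) [df Cf']] := Cf.
split=> [x Wx|]; first by apply: derivableV; [exact: f0|exact: df].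
have Ci := IHk (Ck_pred Cf).
apply: Ck_ext (CkM oW (Ck_cst k W (-1)) (CkM oW (CkM oW Ci Ci) Cf')) => //.
move=> x; rewrite inE => Wx; rewrite deriveV; [|exact: f0|exact: df].
rewrite -[LHS]/(-1 * ((f x)^-1 * (f x)^-1 * 'D_v f x)).
by rewrite mulN1r -[RHS]/(_ * _) mulNr expr2 invfM.
Qed.

Lemma Ck_near_cst k W f : open W ->
  (forall x, W x -> \forall y \near x, f y = f x) -> Ck k W f.
Proof.
move=> oW lf.
have cf x : W x -> {for x, continuous f}.
  move=> Wx; apply: (@near_continuous _ (cst (f x))); last exact: cst_continuous.
  by apply: filterS (lf x Wx) => y ->.
have ne x : W x -> \forall y \near x, cst (f x) y = f y.
  by move=> Wx; apply: filterS (lf x Wx) => y ->.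
case: k => [|k]; split=> // v; split=> [x Wx|].
  exact: near_eq_derivable (ne x Wx) (derivable_cst _ _ _).
apply: Ck_ext (Ck_cst k W 0) => // x; rewrite inE => Wx.
by rewrite -(near_eq_derive v (ne x Wx)) derive_cst.
Qed.

End CkTheory.

(** * Complex functions *)

Section ComplexParts.
Variable R : rcfType.
Implicit Types x y : R[i].

Lemma Re_add x y : complex.Re (x + y) = complex.Re x + complex.Re y.
Proof. by case: x y => [a b] [c d]. Qed.

Lemma Im_add x y : complex.Im (x + y) = complex.Im x + complex.Im y.
Proof. by case: x y => [a b] [c d]. Qed.

Lemma Re_opp x : complex.Re (- x) = - complex.Re x.
Proof. by case: x. Qed.

Lemma Im_opp x : complex.Im (- x) = - complex.Im x.
Proof. by case: x. Qed.

Lemma Re_mul x y : complex.Re (x * y) =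
  complex.Re x * complex.Re y - complex.Im x * complex.Im y.
Proof. by case: x y => [a b] [c d]. Qed.

Lemma Im_mul x y : complex.Im (x * y) =
  complex.Re x * complex.Im y + complex.Im x * complex.Re y.
Proof. by case: x y => [a b] [c d]. Qed.

Lemma Re_sum (I : Type) (r : seq I) (P : pred I) (f : I -> R[i]) :
  complex.Re (\sum_(j <- r | P j) f j) = \sum_(j <- r | P j) complex.Re (f j).
Proof. exact: (big_morph _ Re_add). Qed.

Lemma Im_sum (I : Type) (r : seq I) (P : pred I) (f : I -> R[i]) :
  complex.Im (\sum_(j <- r | P j) f j) = \sum_(j <- r | P j) complex.Im (f j).
Proof. exact: (big_morph _ Im_add). Qed.

Lemma Re_inv x : complex.Re x^-1 =
  complex.Re x / (complex.Re x * complex.Re x + complex.Im x * complex.Im x).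
Proof. by case: x => [a b]. Qed.

Lemma Im_inv x : complex.Im x^-1 =
  - complex.Im x / (complex.Re x * complex.Re x + complex.Im x * complex.Im x).
Proof. by case: x => [a b] /=; rewrite mulNr. Qed.

Lemma complex_eqP x y :
  complex.Re x = complex.Re y -> complex.Im x = complex.Im y -> x = y.
Proof. by case: x y => [a b] [c d] /= -> ->. Qed.

Lemma normsq_neq0 x : x != 0 ->
  complex.Re x * complex.Re x + complex.Im x * complex.Im x != 0.
Proof.
case: x => [a b]; apply: contraNneq => /= /eqP.
rewrite paddr_eq0 -?expr2 ?sqr_ge0 // !sqrf_eq0 => /andP[/eqP -> /eqP ->].
by [].
Qed.

End ComplexParts.

Section FunctionAlgebra.
Variables (X : Type) (F : fieldType) (W : set X) (P : (X -> F) -> Prop).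

(** What smoothness and continuity on a subset have in common: the closure
    properties from which sums, products, integer powers and determinants
    follow. *)
Definition function_algebra : Prop :=
  [/\ forall c, P (fun=> c),
      forall f g, P f -> P g -> P (fun x => f x + g x),
      forall f g, P f -> P g -> P (fun x => f x * g x) &
      forall f, (forall x, W x -> f x != 0) -> P f -> P (fun x => (f x)^-1)].

Hypothesis algP : function_algebra.

Lemma algebra_sum (I : Type) (r : seq I) (Q : pred I) (f : I -> X -> F) :
  (forall i, P (f i)) -> P (fun x => \sum_(i <- r | Q i) f i x).
Proof.
have [Pcst PD _ _] := algP; move=> Pf; elim: r => [|i r IHr].
  by under [X in P X]eq_fun do rewrite big_nil; exact: Pcst.
under [X in P X]eq_fun do rewrite big_cons.
by case: (Q i) => //; exact: PD.
Qed.

Lemma algebra_prod (I : Type) (r : seq I) (Q : pred I) (f : I -> X -> F) :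
  (forall i, P (f i)) -> P (fun x => \prod_(i <- r | Q i) f i x).
Proof.
have [Pcst _ PM _] := algP; move=> Pf; elim: r => [|i r IHr].
  by under [X in P X]eq_fun do rewrite big_nil; exact: Pcst.
under [X in P X]eq_fun do rewrite big_cons.
by case: (Q i) => //; exact: PM.
Qed.

Lemma algebra_exprz f (k : int) : (forall x, W x -> f x != 0) -> P f ->
  P (fun x => f x ^ k).
Proof.
have [Pcst _ PM PV] := algP; move=> f0 Pf.
have PX (n : nat) : P (fun x => f x ^+ n).
  elim: n => [|n IHn].
    by under [X in P X]eq_fun do rewrite expr0; exact: Pcst.
  under [X in P X]eq_fun do rewrite exprS.
  exact: PM.
case: k => n; first exact: PX.
by apply: PV (PX n.+1) => // x Wx; rewrite expf_neq0 // f0.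
Qed.

Lemma algebra_det n (G : X -> 'M[F]_n) : (forall r c, P (fun x => G x r c)) ->
  P (fun x => \det (G x)).
Proof.
have [Pcst _ PM _] := algP; move=> PG; rewrite /determinant.
apply: algebra_sum => s; apply: PM; first exact: Pcst.
by apply: algebra_prod => i; exact: PG.
Qed.

End FunctionAlgebra.

Section SmoothManifoldFunctions.
Variables (R : realType) (m : nat) (M : smoothManifold R m).
Local Notation C := R[i].
Implicit Types W : set M.

Lemma open_coord W (i : chart M) : open W -> open (coord i @` (W `&` dom i)).
Proof.
move=> oW; rewrite openE => u [x [Wx dx] xu].
have : nbhs u (coord i @` dom i).
  by apply: open_nbhs_nbhs; split; [exact: coord_open|exists x].
have ux : (coord i @` dom i) u by exists x.
have : nbhs (param i u) W.
  by rewrite -xu coordK //; apply: open_nbhs_nbhs.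
move=> /(param_continuous ux); rewrite nbhs_filterE => nW nD.
rewrite /interior; near=> v.
have [y dy yv] : (coord i @` dom i) v by near: v.
exists y => //; split=> //.
have : W (param i v) by near: v.
by rewrite -yv coordK.
Unshelve. all: by end_near. Qed.

Lemma smoothR_cst W (c : R) : smoothR W (cst c).
Proof. by move=> i k; exact: Ck_cst. Qed.

Lemma smoothRD W f g : open W -> smoothR W f -> smoothR W g ->
  smoothR W (fun x => f x + g x).
Proof. by move=> oW sf sg i k; apply: CkD; [exact: open_coord|exact: sf|exact: sg]. Qed.

Lemma smoothRM W f g : open W -> smoothR W f -> smoothR W g ->
  smoothR W (fun x => f x * g x).
Proof. by move=> oW sf sg i k; apply: CkM; [exact: open_coord|exact: sf|exact: sg]. Qed.

Lemma smoothRN W f : open W -> smoothR W f -> smoothR W (fun x => - f x).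
Proof.
move=> oW sf; have := smoothRM oW (smoothR_cst W (-1)) sf.
by congr (smoothR W); apply/funext => x; rewrite mulN1r.
Qed.

Lemma smoothRV W f : open W -> (forall x, W x -> f x != 0) -> smoothR W f ->
  smoothR W (fun x => (f x)^-1).
Proof.
move=> oW f0 sf i k; apply: CkV; [exact: open_coord| |exact: sf].
by move=> _ [x [Wx dx] <-]; rewrite /= coordK //; exact: f0.
Qed.

Lemma smoothC_cst W (c : C) : smoothC W (fun=> c).
Proof. by split; exact: smoothR_cst. Qed.

Lemma smoothCD W f g : open W -> smoothC W f -> smoothC W g ->
  smoothC W (fun x => f x + g x).
Proof.
move=> oW [sf1 sf2] [sg1 sg2]; split.
  under [X in smoothR W X]eq_fun do rewrite Re_add.
  exact: smoothRD.
under [X in smoothR W X]eq_fun do rewrite Im_add.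
exact: smoothRD.
Qed.

Lemma smoothCM W f g : open W -> smoothC W f -> smoothC W g ->
  smoothC W (fun x => f x * g x).
Proof.
move=> oW [sf1 sf2] [sg1 sg2]; split.
  under [X in smoothR W X]eq_fun do rewrite Re_mul.
  by apply: smoothRD => //; [|apply: smoothRN => //]; apply: smoothRM.
under [X in smoothR W X]eq_fun do rewrite Im_mul.
by apply: smoothRD => //; apply: smoothRM.
Qed.

Lemma smoothCV W f : open W -> (forall x, W x -> f x != 0) -> smoothC W f ->
  smoothC W (fun x => (f x)^-1).
Proof.
move=> oW f0 [sf1 sf2].
have sn : smoothR W (fun x => (complex.Re (f x) * complex.Re (f x) +
    complex.Im (f x) * complex.Im (f x))^-1).
  apply: smoothRV => // [x Wx|]; first exact: normsq_neq0 (f0 x Wx).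
  by apply: smoothRD => //; apply: smoothRM.
split.
  under [X in smoothR W X]eq_fun do rewrite Re_inv.
  exact: smoothRM.
under [X in smoothR W X]eq_fun do rewrite Im_inv.
by apply: smoothRM => //; exact: smoothRN.
Qed.

Lemma smoothC_algebra W : open W -> function_algebra W (smoothC W).
Proof.
move=> oW; split; [exact: smoothC_cst|move=> f g|move=> f g|move=> f].
- exact: smoothCD.
- exact: smoothCM.
- exact: smoothCV.
Qed.

Lemma smoothR_near_cst W (f : M -> R) : open W ->
  (forall x, W x -> \forall y \near x, W y -> f y = f x) -> smoothR W f.
Proof.
move=> oW lf i k; apply: Ck_near_cst; first exact: open_coord.
move=> _ [x [Wx dx] <-] /=.
have ux : (coord i @` dom i) (coord i x) by exists x.
have : nbhs (param i (coord i x)) [set y | f y = f x].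
  rewrite coordK //; apply: filterS2 (lf x Wx) (open_nbhs_nbhs (conj oW Wx)).
  by move=> y; apply.
by move=> /(param_continuous ux); rewrite nbhs_filterE coordK.
Qed.

Lemma smoothC_near_cst W f : open W ->
  (forall x, W x -> \forall y \near x, W y -> f y = f x) -> smoothC W f.
Proof.
by move=> oW lf; split; apply: smoothR_near_cst => // x Wx;
  apply: filterS (lf x Wx) => y fy Wy; rewrite fy.
Qed.

End SmoothManifoldFunctions.

(** * Complex directional derivatives and logarithmic derivatives *)

Section ComplexDerivative.
Variables (R : realType) (V : normedModType R).
Local Notation C := R[i].
Implicit Types (f g : V -> C) (x v : V) (l : C).

Definition cderive f x v l :=
  is_derive x v (fun u => complex.Re (f u)) (complex.Re l) /\
  is_derive x v (fun u => complex.Im (f u)) (complex.Im l).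

Lemma cderive_eq f x v l l' : cderive f x v l -> l = l' -> cderive f x v l'.
Proof. by move=> ? <-. Qed.

Lemma cderive_near f g x v l : (\forall y \near x, f y = g y) ->
  cderive f x v l -> cderive g x v l.
Proof.
by move=> fg [df1 df2]; split;
  [apply: near_eq_is_derive df1|apply: near_eq_is_derive df2];
  apply: filterS fg => y ->.
Qed.

Lemma cderive_cst (c : C) x v : cderive (fun=> c) x v 0.
Proof. by split; exact: is_derive_cst. Qed.

Lemma cderiveD f g x v l k : cderive f x v l -> cderive g x v k ->
  cderive (fun u => f u + g u) x v (l + k).
Proof.
move=> [f1 f2] [g1 g2]; split.
  under [X in is_derive _ _ X]eq_fun do rewrite Re_add.
  by rewrite Re_add; exact: is_deriveD.
under [X in is_derive _ _ X]eq_fun do rewrite Im_add.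
by rewrite Im_add; exact: is_deriveD.
Qed.

Lemma cderiveM f g x v l k : cderive f x v l -> cderive g x v k ->
  cderive (fun u => f u * g u) x v (l * g x + f x * k).
Proof.
move=> [f1 f2] [g1 g2]; split.
  under [X in is_derive _ _ X]eq_fun do rewrite Re_mul.
  apply: is_derive_eq (is_deriveB (is_deriveM f1 g1) (is_deriveM f2 g2)) _.
rewrite Re_add !Re_mul /GRing.scale /=; ring.
under [X in is_derive _ _ X]eq_fun do rewrite Im_mul.
apply: is_derive_eq (is_deriveD (is_deriveM f1 g2) (is_deriveM f2 g1)) _.
rewrite Im_add !Im_mul /GRing.scale /=; ring.
Qed.

Lemma cderive_sum (I : Type) (r : seq I) (P : pred I) (F : I -> V -> C) x v
    (l : I -> C) : (forall i, cderive (F i) x v (l i)) ->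
  cderive (fun u => \sum_(i <- r | P i) F i u) x v (\sum_(i <- r | P i) l i).
Proof.
move=> dF; elim: r => [|i r IHr].
  by under [X in cderive X]eq_fun do rewrite big_nil; rewrite big_nil;
     exact: cderive_cst.
under [X in cderive X]eq_fun do rewrite big_cons.
by rewrite big_cons; case: (P i) => //; exact: cderiveD.
Qed.

Lemma cderive_prod (I : eqType) (r : seq I) (F : I -> V -> C) x v (l : I -> C) :
  uniq r -> (forall i, cderive (F i) x v (l i)) ->
  cderive (fun u => \prod_(i <- r) F i u) x v
    (\sum_(i <- r) l i * \prod_(k <- r | i != k) F k x).
Proof.
move=> + dF; elim: r => [|i r IHr].
  by under [X in cderive X]eq_fun do rewrite big_nil; rewrite big_nil => _;
     exact: cderive_cst.
move=> /= /andP[ir /IHr {}IHr].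
under [X in cderive X]eq_fun do rewrite big_cons.
apply: cderive_eq (cderiveM (dF i) IHr) _.
rewrite big_cons big_cons eqxx /=; congr (_ * _ + _).
  rewrite big_seq [RHS]big_seq_cond; apply: eq_bigl => k.
  by case: (boolP (k \in r)) => //= kr; case: eqVneq kr ir => //= -> ->.
rewrite mulr_sumr; apply: eq_big_seq => j jr; rewrite big_cons.
have -> : j != i by apply: contraNneq ir => <-.
by rewrite mulrCA.
Qed.

(** As for [det_detRing], the terms of the derivative of Leibniz' formula that
    contain L i j sum to the cofactor. *)
Lemma cderive_det n (T : V -> 'M[C]_n) x v (L : 'M[C]_n) :
  (forall r c, cderive (fun u => T u r c) x v (L r c)) ->
  cderive (fun u => \det (T u)) x v (\tr (L *m \adj (T x))).
Proof.
move=> dT; rewrite /determinant.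
have dS (s : 'S_n) := cderiveM (cderive_cst ((-1) ^+ s) x v)
  (cderive_prod (index_enum_uniq 'I_n) (fun i => dT i (s i))).
apply: cderive_eq (cderive_sum (index_enum _) xpredT dS) _.
under eq_bigr do rewrite mul0r add0r mulr_sumr.
rewrite exchange_big /mxtrace; apply: eq_bigr => i _ /=; rewrite mxE.
rewrite (partition_big (fun s : 'S_n => s i) xpredT) //=; apply: eq_bigr => j _.
rewrite mxE expand_cofactor mulr_sumr; apply: eq_bigr => s /eqP <-.
by rewrite mulrCA.
Qed.

(** Jacobi's formula.  The transport equation provides T' = A T, a coherency map
    compatible with connections T' = A T + T B. *)
Lemma cderive_det_mul n (T : V -> 'M[C]_n) x v (A B : 'M[C]_n) :
  (forall r c, cderive (fun u => T u r c) x v ((A *m T x + T x *m B) r c)) ->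
  cderive (fun u => \det (T u)) x v ((\tr A + \tr B) * \det (T x)).
Proof.
move=> /cderive_det /cderive_eq; apply.
rewrite mulmxDl mxtraceD -mulmxA mul_mx_adj mul_mx_scalar mxtraceZ.
by rewrite -mulmxA mxtrace_mulC -mulmxA mul_adj_mx mul_mx_scalar mxtraceZ mulrDl
  ![\det _ * _]mulrC.
Qed.

(** The derivative of log f along v; integer powers and products of such f are
    then linear combinations. *)
Definition logd f x v l := f x != 0 /\ cderive f x v (l * f x).

Lemma logd_eq f x v l l' : logd f x v l -> l = l' -> logd f x v l'.
Proof. by move=> ? <-. Qed.

Lemma logd_cst (c : C) x v : c != 0 -> logd (fun=> c) x v 0.
Proof. by move=> c0; split=> //; rewrite mul0r; exact: cderive_cst. Qed.

Lemma logdM f g x v l k : logd f x v l -> logd g x v k ->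
  logd (fun u => f u * g u) x v (l + k).
Proof.
move=> [f0 df] [g0 dg]; split; first exact: mulf_neq0.
by apply: cderive_eq (cderiveM df dg) _; ring.
Qed.

Lemma logdV f x v l : logd f x v l -> logd (fun u => (f u)^-1) x v (- l).
Proof.
move=> [f0 [d1 d2]]; split; first by rewrite invr_eq0.
pose N u := complex.Re (f u) * complex.Re (f u) + complex.Im (f u) * complex.Im (f u).
have N0 : N x != 0 by exact: normsq_neq0.
have dN := is_deriveD (is_deriveM d1 d1) (is_deriveM d2 d2).
have dV : is_derive x v (fun u => (N u)^-1) (- (N x) ^- 2 *: 'D_v N x).
  have dNx : derivable N x v by case: dN.
  by split; [exact: derivableV|exact: deriveV].
have {dN} DN : 'D_v N x = _ := @derive_val _ _ _ _ _ _ _ dN.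
rewrite {}DN in dV; split.
  under [X in is_derive _ _ X]eq_fun do rewrite Re_inv -/(N _).
  apply: is_derive_eq (is_deriveM d1 dV) _.
  rewrite mulNr Re_opp !Re_mul !Im_mul Re_inv Im_inv -/(N x) /GRing.scale /=.
  by move: N0; rewrite /N => N0; field; rewrite N0.
under [X in is_derive _ _ X]eq_fun do rewrite Im_inv -/(N _).
apply: is_derive_eq (is_deriveM (is_deriveN d2) dV) _.
rewrite mulNr Im_opp !Im_mul !Re_mul Re_inv Im_inv -/(N x) /GRing.scale /=.
rewrite -[(- _) x]/(- complex.Im (f x)).
by move: N0; rewrite /N => N0; field; rewrite N0.
Qed.

Lemma logd_exprz f x v l (k : int) : logd f x v l ->
  logd (fun u => f u ^ k) x v (l *~ k).
Proof.
move=> df; have dX n : logd (fun u => f u ^+ n) x v (l *+ n).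
  elim: n => [|n IHn].
    by under [X in logd X]eq_fun do rewrite expr0; apply: logd_cst; exact: oner_neq0.
  by under [X in logd X]eq_fun do rewrite exprS; rewrite mulrS; exact: logdM.
case: k => n; first exact: dX.
by rewrite NegzE mulrNz; exact: logdV (dX n.+1).
Qed.

Lemma logd_prod (I : Type) (r : seq I) (P : pred I) (F : I -> V -> C) x v
    (l : I -> C) : (forall i, logd (F i) x v (l i)) ->
  logd (fun u => \prod_(i <- r | P i) F i u) x v (\sum_(i <- r | P i) l i).
Proof.
move=> dF; elim: r => [|i r IHr].
  by under [X in logd X]eq_fun do rewrite big_nil; rewrite big_nil;
     apply: logd_cst; exact: oner_neq0.
under [X in logd X]eq_fun do rewrite big_cons.
by rewrite big_cons; case: (P i) => //; exact: logdM.
Qed.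

End ComplexDerivative.

(** * Linear differential equations *)

Section NonVanishing.
Variable R : realType.
Local Notation C := R[i].

Lemma within_continuous_zero (f : R -> R) :
  {within `[(0 : R), 1], continuous f} -> (forall t : R, 0 < t < 1 -> f t = 0) ->
  f 0 = 0 /\ f 1 = 0.
Proof.
move=> /(continuous_within_itvP f ltr01)[_ f0 f1] fI; split.
  apply: (cvg_unique (@Rhausdorff R) f0).
  have c0 : (fun=> 0 : R) x @[x --> (0 : R)^'+] --> (0 : R) by exact: cvg_cst.
  apply: cvg_trans c0; apply: near_eq_cvg; near=> x.
  rewrite fI //; apply/andP; split; near: x.
    exact: nbhs_right_gt.
  exact: nbhs_right_lt.
apply: (cvg_unique (@Rhausdorff R) f1).
have c0 : (fun=> 0 : R) x @[x --> (1 : R)^'-] --> (0 : R) by exact: cvg_cst.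
apply: cvg_trans c0; apply: near_eq_cvg; near=> x.
rewrite fI //; apply/andP; split; near: x.
  exact: nbhs_left_gt.
exact: nbhs_left_lt.
Unshelve. all: by end_near. Qed.

Lemma is_derive_continuous (f : R -> R) (t l : R) :
  is_derive t 1 f l -> {for t, continuous f}.
Proof.
by move=> [df _]; apply: differentiable_continuous; exact/derivable1_diffP.
Qed.

Lemma is_derive_comp_mull (F : R -> R) (a t l : R) : is_derive (a * t) 1 F l ->
  is_derive t 1 (fun s => F (a * s)) (a * l).
Proof.
move=> dF; have da : is_derive t 1 (fun s : R => a * s) a.
  by apply: is_derive_eq (is_deriveM (is_derive_cst a t 1) (is_derive_id t 1)) _;
     rewrite scaler0 addr0 /GRing.scale /= mulr1.
by apply: is_derive_eq (is_derive1_comp dF da) _; rewrite mulrC.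
Qed.

Lemma is_derive_expRM (a t : R) :
  is_derive t 1 (fun s => expR (a * s)) (a * expR (a * t)).
Proof. exact: is_derive_comp_mull. Qed.

(** Gronwall's argument: v exp(- c s) decreases after t0 and v exp(c s) increases
    before it, and both vanish at t0. *)
Lemma linear_ode_zero (v h : R -> R) (t0 e c : R) :
  (forall s, s \in `]t0 - e, t0 + e[ ->
     [/\ is_derive s 1 v (h s * v s), `|h s| <= c & 0 <= v s]) ->
  v t0 = 0 -> forall s, s \in `]t0 - e, t0 + e[ -> v s = 0.
Proof.
move=> H v0 s sI; have [_ _ vs0] := H s sI.
apply/eqP; rewrite eq_le vs0 andbT.
have e0 : 0 < e by move: sI; rewrite in_itv /= => /andP[]; lra.
have t0I : t0 \in `]t0 - e, t0 + e[ by rewrite in_itv /=; apply/andP; split; lra.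
pose w a := v * (fun s => expR (a * s)).
have dw a r : r \in `]t0 - e, t0 + e[ ->
    is_derive r 1 (w a) ((h r + a) * v r * expR (a * r)).
  move=> /H[dv _ _]; apply: is_derive_eq (is_deriveM dv (is_derive_expRM a r)) _.
  by rewrite /GRing.scale /=; ring.
have cw a r : r \in `]t0 - e, t0 + e[ -> {for r, continuous (w a)}.
  by move=> /(dw a)/is_derive_continuous.
have wt0 a : w a t0 = 0 by rewrite /w /= -[LHS]/(_ * _) v0 mul0r.
have wle a : w a s <= 0 -> v s <= 0.
  by rewrite -[w a s]/(v s * _) pmulr_lle0 ?expR_gt0.
have [ts|/ltW st] := leP t0 s.
  apply: (wle (- c)); rewrite -(wt0 (- c)).
  apply: (@ler0_derive1_le_oo R (w (- c)) (t0 - e) (t0 + e)) => // r rI.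
  - by have [] := dw (- c) r rI.
  - rewrite derive1E (@derive_val _ _ _ _ _ _ _ (dw (- c) r rI)).
    have [_ + vr0] := H r rI; rewrite ler_norml => /andP[_ hc].
    rewrite pmulr_lle0 ?expR_gt0 // mulr_le0_ge0 //; lra.
  - by move: rI; rewrite inE; exact: cw.
apply: (wle c); rewrite -(wt0 c).
apply: (@ger0_derive1_le_oo R (w c) (t0 - e) (t0 + e)) => // r rI.
- by have [] := dw c r rI.
- rewrite derive1E (@derive_val _ _ _ _ _ _ _ (dw c r rI)).
  have [_ + vr0] := H r rI; rewrite ler_norml => /andP[hc _].
  rewrite mulr_ge0 ?expR_ge0 // mulr_ge0 //; lra.
- by move: rI; rewrite inE; exact: cw.
Qed.

(** The zero set in ]0, 1[ is closed, and open by [linear_ode_zero]; if it were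
    not empty it would be all of ]0, 1[, against the initial value.  The
    coefficient is given only locally, since on a manifold it is computed in a
    chart that depends on the point. *)
Lemma linear_ode_neq0 (u : R -> C) : u 0 != 0 ->
  {within `[(0 : R), 1], continuous (fun t : R => complex.Re (u t))} ->
  {within `[(0 : R), 1], continuous (fun t : R => complex.Im (u t))} ->
  (forall t : R, 0 < t < 1 -> exists lam c, \forall s \near t,
     cderive u s (1 : R) (lam s * u s) /\ `|complex.Re (lam s)| <= c) ->
  forall t : R, 0 < t < 1 -> u t != 0.
Proof.
move=> u0 cRe cIm H t tI; apply/negP => /eqP ut.
(* |u|^2 satisfies the real equation v' = 2 Re(lam) v. *)
pose v s := complex.Re (u s) * complex.Re (u s) + complex.Im (u s) * complex.Im (u s).
have v_ge0 s : 0 <= v s by rewrite /v -!expr2 addr_ge0 ?sqr_ge0.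
have vneq0 s : u s != 0 -> v s != 0 by exact: normsq_neq0.
have dv lam s : cderive u s (1 : R) (lam s * u s) ->
    is_derive s 1 v ((2 * complex.Re (lam s)) * v s).
  move=> [d1 d2]; apply: is_derive_eq (is_deriveD (is_deriveM d1 d1) (is_deriveM d2 d2)) _.
  by rewrite Re_mul Im_mul /v /GRing.scale /=; ring.
pose I : set R := `]0, 1[%classic.
pose Z : set R := I `&` [set s | v s = 0].
have vI s : I s -> {for s, continuous v}.
  rewrite /I /= in_itv /= => /H[lam [c /nbhs_singleton[/dv]]].
  by move=> /is_derive_continuous.
have oZ : open Z.
  rewrite openE => s [Is vs0]; have Is' := Is; move: Is'; rewrite /I /= in_itv /=.
  move=> sI; have [lam [c Hc]] := H s sI.
  have nI : \forall r \near s, I r.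
    by apply: open_nbhs_nbhs; split => //; exact: interval_open.
  have : nbhs s ([set r | cderive u r (1 : R) (lam r * u r) /\
      `|complex.Re (lam r)| <= c] `&` I) by exact: filterI.
  move=> /nbhs_ballP[e /= e0 He].
  have He' r : r \in `]s - e, s + e[ -> (cderive u r (1 : R) (lam r * u r) /\
      `|complex.Re (lam r)| <= c) /\ I r.
    rewrite in_itv /= => /andP[r1 r2]; apply: He; rewrite /ball /= ltr_norml; apply/andP; split; lra.
  have Z0 : forall r, r \in `]s - e, s + e[ -> v r = 0.
    apply: (@linear_ode_zero v (fun r => 2 * complex.Re (lam r)) s e (2 * c)) => // r.
    move=> /He'[[/dv ? ?] _]; split=> //.
    by rewrite normrM ger0_norm // ler_pM2l.
  apply/nbhs_ballP; exists e => // r; rewrite /ball /= ltr_norml => /andP[r1 r2].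
  have rI : r \in `]s - e, s + e[ by rewrite in_itv /=; apply/andP; split; lra.
  by split; [have [] := He' r rI|exact: Z0].
have cI : connected I by apply/connected_intervalP; exact: interval_is_interval.
have /cI ZI : Z !=set0.
  by exists t; split; [rewrite /I /= in_itv|rewrite /= /v ut /= mul0r addr0].
have {}ZI : Z = I.
  apply: ZI; first by exists Z => //; rewrite /Z setIA setIid.
  exists (closure Z); first exact: closed_closure.
  apply/seteqP; split => [s Zs|s [Is cs]]; first by split; [case: Zs|exact: subset_closure].
  split=> //=; apply/eqP/negPn/negP => vs0.
  have : nbhs s [set r | v r != 0].
    by apply: (vI s Is [set x | x != 0]); apply: open_nbhs_nbhs; split; [exact: open_neq|exact: vs0].
  by move=> /cs[r [[_ /= ->]]]; rewrite /= eqxx.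
have : {within `[(0 : R), 1], continuous v}.
  by move=> s; apply: cvgD; apply: cvgM; first [exact: cRe|exact: cIm].
move=> /within_continuous_zero[|v00 _].
  move=> s sI; suff [_ ->] : Z s by [].
  by rewrite ZI /I /= in_itv.
by have /negP := vneq0 _ u0; apply; rewrite v00.
Qed.

End NonVanishing.

Section RealOde.
Variable R : realType.

Lemma half_powers_lt (A e : R) : 0 <= A -> 0 < e -> exists n, A / 2 ^+ n < e.
Proof.
move=> A0 e0; exists (Num.trunc (A / e)).+1.
rewrite ltr_pdivrMr ?exprn_gt0 // mulrC -ltr_pdivrMr //.
apply: lt_trans (truncnS_gt _) _.
by rewrite -natrX ltr_nat ltn_expl.
Qed.

Lemma norm_le_half_powers (x A : R) : 0 <= A ->
  (forall n, `|x| <= A / 2 ^+ n) -> x = 0.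
Proof.
move=> A0 H; apply/eqP; apply: contraT; rewrite -normr_gt0 => x0.
have [n] := half_powers_lt A0 x0.
by rewrite ltNge H.
Qed.

(** The limit is the supremum of the nondecreasing minorant
    [u n - 2 A / 2 ^+ n], which lies below every [u n + 2 A / 2 ^+ n]. *)
Lemma geometric_limit (u : nat -> R) (A : R) :
  (forall n, `|u n.+1 - u n| <= A / 2 ^+ n) ->
  exists l, forall n, `|l - u n| <= 2 * A / 2 ^+ n.
Proof.
move=> uA.
pose lo n := u n - 2 * A / 2 ^+ n; pose hi n := u n + 2 * A / 2 ^+ n.
have half n : 2 * A / 2 ^+ n.+1 = A / 2 ^+ n.
  by rewrite exprS; field; rewrite expf_neq0 ?pnatr_eq0.
have dbl n : 2 * A / 2 ^+ n = A / 2 ^+ n + A / 2 ^+ n by field; rewrite expf_neq0 ?pnatr_eq0.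
have step n : lo n <= lo n.+1 /\ hi n.+1 <= hi n.
  rewrite /lo /hi half dbl; have := uA n; rewrite ler_norml => /andP[? ?].
  by split; lra.
have A0 n : 0 <= A / 2 ^+ n by apply: le_trans (uA n).
have lomono n m : (n <= m)%N -> lo n <= lo m.
  move=> /subnK <-; elim: (m - n)%N => // k IHk; rewrite addSn.
  exact: le_trans IHk (step _).1.
have himono n m : (n <= m)%N -> hi m <= hi n.
  move=> /subnK <-; elim: (m - n)%N => // k IHk; rewrite addSn.
  exact: le_trans (step _).2 IHk.
have lohi n m : lo n <= hi m.
  apply: (@le_trans _ _ (lo (maxn n m))); first by apply: lomono; exact: leq_maxl.
  apply: (@le_trans _ _ (hi (maxn n m))); last by apply: himono; exact: leq_maxr.
  by rewrite /lo /hi dbl; have := A0 (maxn n m); lra.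
exists (sup (range lo)) => n; rewrite ler_norml; apply/andP; split.
  have : lo n <= sup (range lo).
    apply: ub_le_sup; last by exists n.
    by exists (hi 0%N) => _ [k _ <-]; exact: lohi.
  by rewrite /lo; lra.
have : sup (range lo) <= hi n.
  by apply: ge_sup; [exists (lo 0%N); exists 0%N|move=> _ [k _ <-]; exact: lohi].
by rewrite /hi; lra.
Qed.

Lemma antiderivative (g : R -> R) : continuous g ->
  exists F : R -> R, F 0 = 0 /\
    forall t : R, -1 < t < 2 -> is_derive t 1 F (g t).
Proof.
move=> cg.
(* Integrating from -1 makes 0 an interior point. *)
pose F x := (\int[lebesgue_measure]_(t in `[(-1 : R), x]) g t)%R.
have ig : lebesgue_measure.-integrable `[(-1 : R), 2] (EFin \o g).
  by apply: continuous_compact_integrable; [exact: segment_compact|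
    exact: continuous_subspaceT].
exists (fun t => F t - F 0); split; first by rewrite subrr.
move=> t /andP[t1 t2].
have [dF DF] := continuous_FTC1_closed t2 ig t1 (cg t).
have dF' : is_derive t 1 F (g t) by split; [exact: dF|rewrite -derive1E].
by apply: is_derive_eq (is_deriveB dF' (is_derive_cst (F 0) t 1)) _; rewrite subr0.
Qed.

(** Integration against the weight exp(L t) gains a factor 1 / L, which makes the
    Picard operator contract on all of [0, 1] once L exceeds twice the size of
    the coefficients. *)
Lemma weighted_bound (F g : R -> R) (K L : R) : 0 <= K -> 0 < L -> F 0 = 0 ->
  {within `[(0 : R), 1], continuous F} ->
  (forall t : R, 0 < t < 1 -> is_derive t 1 F (g t) /\ `|g t| <= K * expR (L * t)) ->
  forall t : R, 0 <= t <= 1 -> `|F t| <= K / L * expR (L * t).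
Proof.
move=> K0 L0 F0 cF dF.
have KL : K / L * L = K by rewrite divfK // gt_eqF.
have main (G h : R -> R) : G 0 = 0 -> {within `[(0 : R), 1], continuous G} ->
    (forall t : R, 0 < t < 1 -> is_derive t 1 G (h t) /\ `|h t| <= K * expR (L * t)) ->
    forall t : R, 0 <= t <= 1 -> 0 <= K / L * expR (L * t) + G t.
  move=> G0 cG dG t tI; pose H := (fun s => K / L * expR (L * s)) + G.
  have dH (s : R) : 0 < s < 1 -> is_derive s 1 H (K * expR (L * s) + h s).
    move=> /dG[dGs _].
    apply: is_derive_eq (is_deriveD (is_deriveM (is_derive_cst (K / L) s 1) (is_derive_expRM L s)) dGs) _.
    by rewrite scaler0 addr0 /GRing.scale /= mulrA KL.
  have cH : {within `[(0 : R), 1], continuous H}.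
    have cE : {within `[(0 : R), 1], continuous (fun s : R => K / L * expR (L * s))}.
      apply: continuous_subspaceT => r; apply: cvgM; first exact: cvg_cst.
      exact: is_derive_continuous (is_derive_expRM L r).
    by move=> s; apply: cvgD; [exact: cE|exact: cG].
  have -> : K / L * expR (L * t) + G t = H t by [].
  apply: (@le_trans _ _ (H 0)).
    by rewrite -[H 0]/(_ + _) G0 addr0 mulr0 expR0 mulr1 divr_ge0 // ltW.
  have t01 : t \in `[(0 : R), 1] by rewrite in_itv.
  have o01 : 0 \in `[(0 : R), 1] by rewrite in_itv /= lexx ler01.
  have t0 : 0 <= t by case/andP: tI.
  apply: (@ger0_derive1_le_cc R H 0 1 _ _ cH 0 t o01 t01 t0).
  - by move=> s; rewrite in_itv /= => /dH[].
  - move=> s; rewrite in_itv /= => sI; have [_ hs] := dG s sI.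
    rewrite derive1E (@derive_val _ _ _ _ _ _ _ (dH s sI)).
    by move: hs; rewrite ler_norml => /andP[]; lra.
move=> t tI; rewrite ler_norml; apply/andP; split.
  by have := main F g F0 cF dF t tI; lra.
have := main (- F) (- g) _ _ _ t tI.
rewrite -[(- F) t]/(- F t) subr_ge0; apply.
- by rewrite -[(- F) 0]/(- F 0) F0 oppr0.
- by move=> s; apply: cvgN; exact: cF.
- move=> s /dF[dFs gs]; split; first exact: is_deriveN.
  by rewrite -[(- g) s]/(- g s) normrN.
Qed.

Definition clamp (t : R) : R := Num.max 0 (Num.min 1 t).

Lemma clamp_itv t : 0 <= clamp t <= 1.
Proof. by rewrite /clamp le_max lexx /= ge_max ler01 ge_min lexx. Qed.

Lemma clamp_id t : 0 <= t <= 1 -> clamp t = t.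
Proof. by move=> /andP[t0 t1]; rewrite /clamp (min_idPr t1) (max_idPr t0). Qed.

Lemma clamp_continuous : continuous clamp.
Proof.
move=> t; apply: (@continuous_max R R (cst 0) (fun t => Num.min 1 t)).
  exact: cvg_cst.
by apply: (@continuous_min R R (cst 1) id); [exact: cvg_cst|exact: cvg_id].
Qed.

Lemma sum_continuous (J : finType) (f : J -> R -> R) (t : R) :
  (forall j, {for t, continuous (f j)}) ->
  {for t, continuous (fun s => \sum_j f j s)}.
Proof.
move=> cf; rewrite /prop_for /continuous_at.
elim: (index_enum J) => [|j r IHr].
  rewrite big_nil (_ : (fun _ => _) = cst 0); first exact: cvg_cst.
  by apply/funext => s; rewrite big_nil.
rewrite big_cons (_ : (fun _ => _) = (fun s => f j s + \sum_(k <- r) f k s)).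
  by apply: cvgD => //; exact: cf.
by apply/funext => s; rewrite big_cons.
Qed.

Lemma family_bound (J : finType) (f : J -> R -> R) :
  (forall j, continuous (f j)) ->
  exists2 K, 0 <= K & forall t : R, 0 <= t <= 1 -> \sum_j `|f j t| <= K.
Proof.
move=> cf; have cn : continuous (fun t => \sum_j `|f j t|).
  by move=> t; apply: sum_continuous => j; apply: cvg_norm; exact: cf.
have [c cI cmax] := @EVT_max R _ 0 1 ler01 (continuous_subspaceT cn).
exists (\sum_j `|f j c|); first by apply: sumr_ge0 => j _; exact: normr_ge0.
by move=> t tI; apply: cmax; rewrite in_itv.
Qed.

Variables (I : finType) (b : I -> I -> R -> R) (y0 : I -> R).
Hypothesis cb : forall i j, continuous (b i j).

Let rhs (y : I -> R -> R) i t := \sum_j b i j t * y j t.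

Lemma rhs_continuous y : (forall i, continuous (y i)) ->
  forall i, continuous (rhs y i).
Proof.
move=> cy i t; apply: (@sum_continuous I (fun j t => b i j t * y j t)) => j.
by apply: cvgM; [exact: cb|exact: cy].
Qed.

(** Picard iteration for y' = b y; the iterates are clamped to [0, 1] so as to be
    continuous on the whole line. *)
Lemma linear_ode_exists : exists y : I -> R -> R,
  [/\ forall i, y i 0 = y0 i, forall i, continuous (y i) &
      forall i (t : R), 0 < t < 1 -> is_derive t 1 (y i) (\sum_j b i j t * y j t)].
Proof.
(* A total primitive operator, with junk values off the continuous functions. *)
have primE (g : R -> R) : exists F : R -> R, continuous g ->
    F 0 = 0 /\ forall t : R, -1 < t < 2 -> is_derive t 1 F (g t).
  have [cg|ncg] := pselect (continuous g); last by exists g.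
  by have [F ?] := antiderivative cg; exists F.
have [prim primP] := choice primE.
pose Phi (y : I -> R -> R) i t := y0 i + prim (rhs y i) (clamp t).
have Phi0 y i : (forall i, continuous (y i)) -> Phi y i 0 = y0 i.
  move=> /rhs_continuous/(_ i)/primP[p0 _].
  by rewrite /Phi clamp_id ?lexx ?ler01 // p0 addr0.
have Phi_cont y i : (forall i, continuous (y i)) -> continuous (Phi y i).
  move=> /rhs_continuous/(_ i)/primP[_ dp] t.
  apply: cvgD; first exact: cvg_cst.
  apply: (@continuous_comp _ _ _ clamp (prim (rhs y i))); first exact: clamp_continuous.
  by apply: is_derive_continuous (dp _ _); have /andP[] := clamp_itv t; lra.
have Phi_derive y i (t : R) : (forall i, continuous (y i)) -> 0 < t < 1 ->
    is_derive t 1 (Phi y i) (rhs y i t).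
  move=> /rhs_continuous/(_ i)/primP[_ dp] tI.
  have near_eq : \forall s \near t, y0 i + prim (rhs y i) s = Phi y i s.
    have : \forall s \near t, s \in `]0, 1[ by apply: near_in_itvoo; rewrite in_itv.
    apply: filterS => s; rewrite in_itv /= => /andP[s0 s1].
    by rewrite /Phi clamp_id // !ltW.
  apply: near_eq_is_derive near_eq _.
  have tI2 : -1 < t < 2 by case/andP: tI; lra.
  apply: is_derive_eq (is_deriveD (is_derive_cst (y0 i) t 1) (dp t tI2)) _.
  by rewrite add0r.
have [B B0 HB] := @family_bound (I * I)%type (fun p => b p.1 p.2) (fun p => @cb p.1 p.2).
have rowB i (t : R) : 0 <= t <= 1 -> \sum_j `|b i j t| <= B.
  move=> /HB; apply: le_trans.
  rewrite -(pair_bigA _ (fun i j => `|b i j t|)) /= [leRHS](bigD1 i) //= lerDl.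
  by apply: sumr_ge0 => k _; apply: sumr_ge0 => j _; exact: normr_ge0.
pose L := 2 * B + 1.
have L0 : 0 < L by rewrite /L; lra.
have Phi_contr y z K : 0 <= K -> (forall i, continuous (y i)) ->
    (forall i, continuous (z i)) ->
    (forall j (t : R), 0 <= t <= 1 -> `|y j t - z j t| <= K * expR (L * t)) ->
    forall i (t : R), 0 <= t <= 1 -> `|Phi y i t - Phi z i t| <= K / 2 * expR (L * t).
  move=> K0 cy cz yz i t tI.
  apply: (@le_trans _ _ (B * K / L * expR (L * t))); last first.
    rewrite ler_pM2r ?expR_gt0 // ler_pdivrMr // /L.
    have : 0 <= B * K by rewrite mulr_ge0.
    lra.
  apply: (@weighted_bound (fun t => Phi y i t - Phi z i t)
    (fun t => rhs y i t - rhs z i t)) => //.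
  - by rewrite mulr_ge0.
  - by rewrite !Phi0 // subrr.
  - apply: continuous_subspaceT => s.
    by apply: cvgB; apply: Phi_cont.
  - move=> s sI; split; first by apply: is_deriveB; apply: Phi_derive.
    have sI' : 0 <= s <= 1 by case/andP: sI => /ltW-> /ltW->.
    rewrite /rhs -sumrB; apply: le_trans (ler_norm_sum _ _ _) _.
    apply: (@le_trans _ _ (\sum_j `|b i j s| * (K * expR (L * s)))).
      apply: ler_sum => j _; rewrite -mulrBr normrM ler_wpM2l ?normr_ge0 //.
      exact: yz.
    rewrite -mulr_suml -mulrA ler_wpM2r ?rowB //.
    by rewrite mulr_ge0 // expR_ge0.
(* Successive iterates differ by K / 2 ^+ n in the weighted norm. *)
pose Y n := iter n Phi (fun i => cst (y0 i)).
have Y_cont n i : continuous (Y n i).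
  elim: n i => [|n IHn] i; first by move=> t; exact: cvg_cst.
  exact: Phi_cont.
have [K K0 HK] := @family_bound I (fun i t => Y 1%N i t - Y 0%N i t)
  (fun i t => cvgB (Y_cont 1%N i t) (Y_cont 0%N i t)).
have Y_step n i (t : R) : 0 <= t <= 1 ->
    `|Y n.+1 i t - Y n i t| <= K / 2 ^+ n * expR (L * t).
  elim: n i t => [|n IHn] i t tI.
    rewrite expr0 divr1; apply: (@le_trans _ _ K).
      apply: le_trans (HK t tI); rewrite (bigD1 i) //= lerDl.
      by apply: sumr_ge0 => j _; exact: normr_ge0.
    rewrite ler_peMr // -[leLHS]expR0 ler_expR mulr_ge0 ?(ltW L0) //.
    by case/andP: tI.
  rewrite exprSr invfM mulrA.
  apply: (Phi_contr _ _ _ _ (Y_cont n.+1) (Y_cont n) IHn i t tI).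
  by rewrite divr_ge0 // exprn_ge0.
have limE (p : I * R) : exists l, forall n,
    `|l - Y n p.1 (clamp p.2)| <= 2 * (K * expR (L * clamp p.2)) / 2 ^+ n.
  apply: (geometric_limit (u := fun k => Y k p.1 (clamp p.2)))  => n.
  apply: le_trans (Y_step n p.1 _ (clamp_itv p.2)) _.
  by rewrite mulrAC.
have [U0 U0P] := choice limE; pose U i t := U0 (i, t).
have UP n i t : `|U i t - Y n i (clamp t)| <= 2 * (K * expR L) / 2 ^+ n.
  apply: le_trans (U0P (i, t) n) _ => /=.
  rewrite ler_wpM2r ?invr_ge0 ?exprn_ge0 // ler_wpM2l // ler_wpM2l //.
  rewrite ler_expR ler_piMr ?(ltW L0) //; by case/andP: (clamp_itv t).
have A0 : 0 <= 2 * (K * expR L) by rewrite !mulr_ge0 // expR_ge0.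
have U_cont i : continuous (U i).
  move=> t; apply/cvgrPdist_lt => e e0.
  have [n hn] : exists n, 2 * (K * expR L) / 2 ^+ n < e / 3.
    by apply: half_powers_lt => //; rewrite divr_gt0.
  have cYc : {for t, continuous (Y n i \o clamp)}.
    by apply: continuous_comp; [exact: clamp_continuous|exact: Y_cont].
  have /cvgrPdist_lt/(_ (e / 3)) := cYc; rewrite divr_gt0 // => /(_ isT).
  apply: filterS => s /= hs.
  have := UP n i t; have := UP n i s; move: hs hn.
  rewrite !ltr_norml !ler_norml => /andP[? ?] ? /andP[? ?] /andP[? ?].
  by apply/andP; split; lra.
have U_fix i (t : R) : 0 <= t <= 1 -> Phi U i t = U i t.
  move=> tI; apply/eqP; rewrite -subr_eq0; apply/eqP.
  apply: (norm_le_half_powers A0) => n.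
  have cK : 0 <= 2 * K / 2 ^+ n by rewrite divr_ge0 ?exprn_ge0 ?mulr_ge0.
  have h1 : `|Phi U i t - Y n.+1 i t| <= 2 * K / 2 ^+ n / 2 * expR (L * t).
    apply: Phi_contr => // j s sI; have := U0P (j, s) n; rewrite /= clamp_id //.
    by congr (_ <= _); ring.
  have h2 := U0P (i, t) n.+1; rewrite /= clamp_id // in h2.
  have Le : expR (L * t) <= expR L.
    by rewrite ler_expR ler_piMr ?(ltW L0) //; case/andP: tI.
  have -> : Phi U i t - U i t = (Phi U i t - Y n.+1 i t) - (U i t - Y n.+1 i t) by ring.
  apply: le_trans (ler_normB _ _) _.
  apply: le_trans (lerD h1 h2) _.
  have -> : 2 * K / 2 ^+ n / 2 * expR (L * t) +
      2 * (K * expR (L * t)) / 2 ^+ n.+1 = 2 * K / 2 ^+ n * expR (L * t).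
    by rewrite exprS; field; rewrite expf_neq0 // pnatr_eq0.
  have -> : 2 * (K * expR L) / 2 ^+ n = 2 * K / 2 ^+ n * expR L by ring.
  exact: ler_wpM2l.
exists (Phi U); split=> [i|i|i t tI]; [exact: Phi0|exact: Phi_cont|].
apply: is_derive_eq (Phi_derive U i t U_cont tI) _.
apply: eq_bigr => j _; rewrite U_fix //.
by case/andP: tI => /ltW-> /ltW->.
Qed.

End RealOde.

Section MatrixOde.
Variable R : realType.
Local Notation C := R[i].

(** Each column solves a real linear system of size 2k in its real and imaginary
    parts. *)
Lemma matrix_ode_exists k (B : R -> 'M[C]_k) :
  (forall r c, continuous (fun t => complex.Re (B t r c)) /\
               continuous (fun t => complex.Im (B t r c))) ->
  exists T : R -> 'M[C]_k,
    [/\ T 0 = 1%:M,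
        forall r c, continuous (fun t => complex.Re (T t r c)) /\
                    continuous (fun t => complex.Im (T t r c)) &
        forall t : R, 0 < t < 1 -> forall r c,
          cderive (fun u => T u r c) t (1 : R) ((B t *m T t) r c)].
Proof.
move=> cB.
pose b (p q : bool * 'I_k) (t : R) : R :=
  if p.1 == q.1 then complex.Re (B t p.2 q.2)
  else if p.1 then complex.Im (B t p.2 q.2) else - complex.Im (B t p.2 q.2).
have cb p q : continuous (b p q).
  rewrite /b => t; have [cR cI] := cB p.2 q.2.
  case: (p.1 == q.1); first exact: cR.
  by case: p.1; [exact: cI|apply: cvgN; exact: cI].
pose y0 (c : 'I_k) (p : bool * 'I_k) : R := if p.1 then 0 else (p.2 == c)%:R.
have odeE c := linear_ode_exists (y0 c) cb.
have [y yP] := choice odeE.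
exists (fun t => \matrix_(r, c) (y c (false, r) t +i* y c (true, r) t)); split.
- apply/matrixP => r c; rewrite !mxE; have [-> _ _] := yP c.
  by have [-> _ _] := yP c; rewrite /y0 /=; case: (r == c).
- move=> r c; have [_ cy _] := yP c; split.
    by under [X in continuous X]eq_fun do rewrite mxE; exact: cy.
  by under [X in continuous X]eq_fun do rewrite mxE; exact: cy.
move=> t tI r c; have [_ _ dy] := yP c.
have sumE (f : bool * 'I_k -> R) :
    \sum_p f p = \sum_j f (true, j) + \sum_j f (false, j).
  have -> : \sum_p f p = \sum_p f (p.1, p.2) by apply: eq_bigr => -[].
  by rewrite -(pair_bigA _ (fun s j => f (s, j))) big_bool.
split; under [X in is_derive _ _ X]eq_fun do rewrite mxE /=.
  apply: is_derive_eq (dy (false, r) t tI) _.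
  rewrite sumE mxE Re_sum -big_split /=; apply: eq_bigr => j _.
  by rewrite mxE Re_mul /b /=; ring.
apply: is_derive_eq (dy (true, r) t tI) _.
rewrite sumE mxE Im_sum -big_split /=; apply: eq_bigr => j _.
by rewrite mxE Im_mul /b /=; ring.
Qed.

Definition ccontinuous_on (f : R -> C) : Prop :=
  {within `[(0 : R), 1], continuous (fun t : R => complex.Re (f t))} /\
  {within `[(0 : R), 1], continuous (fun t : R => complex.Im (f t))}.

Lemma ccontinuous_algebra : function_algebra `[(0 : R), 1]%classic ccontinuous_on.
Proof.
split=> [c|f g [f1 f2] [g1 g2]|f g [f1 f2] [g1 g2]|f f0 [f1 f2]].
- by split=> t; exact: cvg_cst.
- split=> t; under [X in continuous_at _ X]eq_fun do rewrite (Re_add, Im_add).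
    by apply: cvgD; [exact: f1|exact: g1].
  by apply: cvgD; [exact: f2|exact: g2].
- split=> t; under [X in continuous_at _ X]eq_fun do rewrite (Re_mul, Im_mul).
    by apply: cvgB; apply: cvgM; first [exact: f1|exact: g1|exact: f2|exact: g2].
  by apply: cvgD; apply: cvgM; first [exact: f1|exact: g1|exact: f2|exact: g2].
pose N t := complex.Re (f t) * complex.Re (f t) + complex.Im (f t) * complex.Im (f t).
have cN : {within `[(0 : R), 1], continuous (fun t => (N t)^-1)}.
  apply/subspace_continuousP => t tI; apply: cvgV.
    exact: normsq_neq0 (f0 t tI).
  by move/subspace_continuousP: f1 => f1; move/subspace_continuousP: f2 => f2;
     apply: cvgD; apply: cvgM; first [exact: f1|exact: f2].
split=> t; under [X in continuous_at _ X]eq_fun do rewrite (Re_inv, Im_inv).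
  by apply: cvgM; [exact: f1|exact: cN].
by apply: cvgM; [apply: cvgN; exact: f2|exact: cN].
Qed.

(** The quotient u / w has derivative zero on ]0, 1[, so u is a multiple of w there,
    and by continuity at both ends. *)
Lemma linear_ode_unique (u w : R -> C) : u 0 != 0 -> u 0 = w 0 ->
  ccontinuous_on u -> ccontinuous_on w ->
  (forall t : R, 0 < t < 1 -> exists lam c, \forall s \near t,
     [/\ cderive u s (1 : R) (lam s * u s), cderive w s (1 : R) (lam s * w s) &
         `|complex.Re (lam s)| <= c]) ->
  u 1 = w 1.
Proof.
move=> u0 uw0 cu cw H.
have w0 t : 0 < t < 1 -> w t != 0.
  apply: (@linear_ode_neq0 R w); rewrite -?uw0 //; [exact: cw.1|exact: cw.2|].
  by move=> s /H[lam [c Hc]]; exists lam, c; apply: filterS Hc => r [].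
have dq t : 0 < t < 1 -> cderive (fun s => u s * (w s)^-1) t (1 : R) 0.
  move=> tI; have [lam [c /nbhs_singleton[du dw _]]] := H t tI.
  have [_ dV] := logdV (conj (w0 t tI) dw).
  by apply: cderive_eq (cderiveM du dV) _; ring.
pose q := u (1 / 2) / w (1 / 2).
have h2 : 0 < (1 / 2 : R) < 1 by apply/andP; split; lra.
have const (g : R -> R) : (forall t : R, 0 < t < 1 -> is_derive t 1 g 0) ->
    forall t : R, 0 < t < 1 -> g t = g (1 / 2).
  move=> dg; have key (a b : R) : 0 < a -> a <= b -> b < 1 -> g a = g b.
    move=> a0 ab b1; apply/eqP; rewrite eq_sym -subr_eq0; apply/eqP.
    have dg' x : x \in `]a, b[ -> is_derive x 1 g 0.
      by rewrite in_itv /= => /andP[ax xb]; apply: dg; apply/andP; split; lra.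
    have cg : {within `[a, b], continuous g}.
      apply: continuous_in_subspaceT => x; rewrite inE /= in_itv /= => /andP[ax xb].
      apply: is_derive_continuous (dg x _); apply/andP; split; lra.
    by have [x _ ->] := MVT_segment ab dg' cg; rewrite mul0r.
  move=> t /andP[t0 t1]; have [th|ht] := leP t (1 / 2).
    by apply: key => //; lra.
  by apply/esym; apply: key; lra.
have uq t : 0 < t < 1 -> u t = q * w t.
  move=> tI; have -> : q = u t / w t; last by rewrite divfK // w0.
  by apply: complex_eqP; apply/esym; [apply: (const (fun s => complex.Re (u s / w s)))|
    apply: (const (fun s => complex.Im (u s / w s)))] => // s /dq[].
have [Pc PD PM _] := ccontinuous_algebra.
have [c1 c2] := PD _ _ cu (PM _ _ (Pc (- q)) cw).
have z t : 0 < t < 1 -> u t + - q * w t = 0 by move=> /uq ->; ring.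
have [zr0 zr1] := within_continuous_zero c1 (fun t tI => congr1 (@complex.Re R) (z t tI)).
have [zi0 zi1] := within_continuous_zero c2 (fun t tI => congr1 (@complex.Im R) (z t tI)).
have e0 : u 0 + - q * w 0 = 0 by exact: complex_eqP.
have e1 : u 1 + - q * w 1 = 0 by exact: complex_eqP.
have q1 : q = 1.
  apply/eqP; rewrite eq_sym -subr_eq0 -(mulIr_eq0 _ (mulIf u0)); apply/eqP.
  by rewrite mulrBl mul1r -[RHS]e0 -uw0; ring.
by apply/eqP; rewrite -subr_eq0; apply/eqP; rewrite -[RHS]e1 q1; ring.
Qed.

End MatrixOde.

(** * Parallel transport *)

Section Lines.
Variables (R : realType) (V : normedModType R).
Implicit Types (F : V -> R) (p v x : V).

(** Smoothness is expressed by directional derivatives; along a line their chain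
    rule is an equality of difference quotients. *)
Lemma line_derivable F p v (t w : R) :
  derivable (fun s : R => F (p + s *: v)) t w = derivable F (p + t *: v) (w *: v).
Proof.
rewrite /derivable; set g1 := fun h => h^-1 *: _; set g2 := fun h => h^-1 *: _.
suff -> : g1 = g2 by [].
by apply/funext => h; rewrite /g1 /g2 /= scalerDl addrCA scalerA.
Qed.

Lemma line_derive F p v (t w : R) :
  'D_w (fun s : R => F (p + s *: v)) t = 'D_(w *: v) F (p + t *: v).
Proof.
rewrite /derive; set g1 := fun h => h^-1 *: _; set g2 := fun h => h^-1 *: _.
suff -> : g1 = g2 by [].
by apply/funext => h; rewrite /g1 /g2 /= scalerDl addrCA scalerA.
Qed.

Lemma is_derive_scale F x v l (s : R) :
  is_derive x v F l -> is_derive x (s *: v) F (s * l).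
Proof.
move=> [dF DF]; pose g := fun r : R => F (x + r *: v).
have x0 : x = x + 0 *: v by rewrite scale0r addr0.
have dg : derivable g 0 1 by rewrite line_derivable -x0 scale1r.
have Dg : differentiable g 0 by exact/derivable1_diffP.
split; first by rewrite [x in derivable _ x]x0 -line_derivable; exact: diff_derivable.
rewrite [x in derive _ x]x0 -line_derive deriveE // -[X in 'd g 0 X]mulr1.
rewrite [LHS]linearZ /= -deriveE // line_derive -x0 scale1r DF.
by [].
Qed.

Lemma Ck_line k (W : set V) F p v :
  Ck k W F -> Ck k [set t : R | W (p + t *: v)] (fun t => F (p + t *: v)).
Proof.
have cl (t : R) : {for t, continuous (fun s : R => p + s *: v)}.
  by apply: cvgD; [exact: cvg_cst|apply: cvgZl; exact: cvg_id].
elim: k F => [|k IHk] F CF.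
  split=> // t Wt; apply: (@continuous_comp _ _ _ (fun s : R => p + s *: v) F) => //.
  exact: Ck_continuous CF _ Wt.
split=> [t Wt|w].
  apply: (@continuous_comp _ _ _ (fun s : R => p + s *: v) F) => //.
  exact: Ck_continuous CF _ Wt.
have [_ /(_ (w *: v)) [dF CDF]] := CF; split=> [t Wt|].
  by rewrite line_derivable; exact: dF.
have -> : 'D_w (fun s : R => F (p + s *: v)) = (fun t => 'D_(w *: v) F (p + t *: v)).
  by apply/funext => t; exact: line_derive.
exact: (IHk ('D_(w *: v) F) CDF).
Qed.

Lemma Ck_sub k (W1 W2 : set V) F : W1 `<=` W2 -> Ck k W2 F -> Ck k W1 F.
Proof.
move=> W12; elim: k F => [|k IHk] F [cF dF]; (split; first by move=> x /W12/cF) => //.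
by move=> v; have [df Cf] := dF v; split; [move=> x /W12/df|exact: IHk].
Qed.

End Lines.

Section PathsAndFlows.
Variables (R : realType) (m : nat) (M : smoothManifold R m).
Local Notation C := R[i].

Lemma smoothR_continuous (W : set M) (g : M -> R) x :
  open W -> smoothR W g -> W x -> {for x, continuous g}.
Proof.
move=> oW sg Wx; have [i dx] := dom_cover x.
have cg : {for coord i x, continuous (g \o param i)}.
  by apply: (Ck_continuous (sg i 0%N)); exists x.
apply: (@near_continuous R M ((g \o param i) \o coord i)).
  have := open_nbhs_nbhs (conj (@dom_open _ _ M i) dx).
  by apply: filterS => y dy; rewrite /= coordK.
by apply: continuous_comp => //; exact: coord_continuous.
Qed.

(** A(f'(t)) computed in the chart i; the transport equation reads
    T' = - [path_coef A f i] T. *)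
Definition path_coef k (A : conn M k) (f : R -> M) (i : chart M) (t : R) : 'M[C]_k :=
  \sum_(a < m) (velocity f i a t)%:C *: A i a (f t).

(** A fundamental solution, of which [transport] records the value at 1. *)
Definition flow k (A : conn M k) (f : R -> M) (T : R -> 'M[C]_k) : Prop :=
  [/\ T 0 = 1%:M, forall r c, ccontinuous_on (fun t => T t r c) &
      forall (t : R) i, 0 < t < 1 -> dom i (f t) -> forall r c,
        cderive (fun u => T u r c) t (1 : R) ((- path_coef A f i t *m T t) r c)].

Lemma transportP k (A : conn M k) f P :
  transport A f P <-> exists2 T, flow A f T & T 1 = P.
Proof.
by split=> [[T [T0 T1 cT dT]]|[T [T0 cT dT] T1]]; exists T.
Qed.

Lemma Re_mulC (a : R) (z : C) : complex.Re (a%:C * z) = a * complex.Re z.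
Proof. by case: z => x y /=; rewrite mul0r subr0. Qed.

Lemma trace_path_coef k (A : conn M k) f i t : \tr (- path_coef A f i t) =
  - \sum_(a < m) (velocity f i a t)%:C * \tr (A i a (f t)).
Proof.
have trN (X : 'M[C]_k) : \tr (- X) = - \tr X by exact: raddfN.
have trS (F : 'I_m -> 'M[C]_k) : \tr (\sum_a F a) = \sum_a \tr (F a).
  exact: raddf_sum.
rewrite trN trS; congr (- _).
by apply: eq_bigr => a _; rewrite mxtraceZ.
Qed.

Section Trace.
Variables (k : nat) (A : conn M k) (W : set M) (f : R -> M).
Hypotheses (oW : open W) (Aconn : is_connection W A) (fW : smooth_path W f).

Lemma path_coef_bounded (t : R) i : 0 < t < 1 -> dom i (f t) ->
  exists c, \forall s \near t,
    [/\ dom i (f s), 0 < s < 1 & `|complex.Re (\tr (- path_coef A f i s))| <= c].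
Proof.
move=> tI dt; have [fI [e [e0 cf sf]]] := fW.
have tI1 : 0 <= t <= 1 by case/andP: tI => /ltW-> /ltW->.
have Wt := fI t tI1.
have te : - e < t < 1 + e by case/andP: tI => ? ?; apply/andP; split; lra.
have cft := cf t te.
pose h s := - \sum_(a < m) velocity f i a s * complex.Re (\tr (A i a (f s))).
have hE s : complex.Re (\tr (- path_coef A f i s)) = h s.
  rewrite trace_path_coef Re_opp Re_sum.
  by congr (- _); apply: eq_bigr => a _; rewrite Re_mulC.
have ch : {for t, continuous h}.
  apply: continuousN; apply: sum_continuous => a; apply: continuousM.
    have [_ /(_ 1)[_ C0]] := sf i a 1%N.
    by case: C0 => C0 _; exact: (C0 t (conj te dt)).
  apply: (@continuous_comp _ _ _ f (fun x => complex.Re (\tr (A i a x)))) => //.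
  apply: (@smoothR_continuous (W `&` dom i)) => //; first exact: openI oW (@dom_open _ _ M i).
  have oWi : open (W `&` dom i) by exact: openI oW (@dom_open _ _ M i).
  have [] := algebra_sum (smoothC_algebra oWi) (index_enum 'I_k) xpredT
    (fun r => Aconn.1 i a r r).
  by [].
exists (`|h t| + 1).
have n1 : \forall s \near t, 0 < s < 1.
  have : \forall s \near t, s \in `]0, 1[ by apply: near_in_itvoo; rewrite in_itv.
  by apply: filterS => s; rewrite in_itv.
have n2 : \forall s \near t, dom i (f s).
  by apply: (cft); apply: open_nbhs_nbhs; split => //; exact: dom_open.
have n3 : \forall s \near t, `|h t - h s| < 1.
  by have /cvgrPdist_lt/(_ _ ltr01) := ch.
near=> s; split; [by near: s|by near: s|].
rewrite hE; have -> : h s = h t - (h t - h s) by ring.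
apply: le_trans (ler_normB _ _) _; rewrite lerD2l; apply: ltW.
by near: s.
Unshelve. all: by end_near. Qed.

(** Liouville's formula, with the resulting invertibility of T. *)
Lemma flow_det (T : R -> 'M[C]_k) : flow A f T ->
  forall (t : R) i, 0 < t < 1 -> dom i (f t) ->
    logd (fun s => \det (T s)) t (1 : R) (\tr (- path_coef A f i t)).
Proof.
move=> [T0 cT dT] t i tI dt.
have dD (s : R) j : 0 < s < 1 -> dom j (f s) ->
    cderive (fun s => \det (T s)) s (1 : R) (\tr (- path_coef A f j s) * \det (T s)).
  move=> sI ds; have := @cderive_det_mul _ _ _ T s (1 : R) (- path_coef A f j s) 0.
  rewrite mxtrace0 addr0; apply=> r c; rewrite mulmx0 addr0.
  exact: dT.
split; last exact: dD.
have [cR cI] := algebra_det (@ccontinuous_algebra R) cT.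
apply: (linear_ode_neq0 _ cR cI) tI => [|s sI]; first by rewrite T0 det1 oner_neq0.
have [j dj] := dom_cover (f s); have [c Hc] := path_coef_bounded sI dj.
exists (fun r => \tr (- path_coef A f j r)), c; apply: filterS Hc => r [dr rI hr].
by split=> //; exact: dD.
Qed.

End Trace.

Lemma flow_unique1 (A : conn M 1) (W : set M) (f : R -> M) (P Q : 'M[C]_1) :
  open W -> is_connection W A -> smooth_path W f ->
  transport A f P -> transport A f Q -> P = Q.
Proof.
move=> oW Aconn fW /transportP[S [S0 cS dS] <-] /transportP[T [T0 cT dT] <-].
apply/matrixP => r c; rewrite !ord1; apply: (linear_ode_unique _ _ (cS 0 0) (cT 0 0)).
- by rewrite S0 mxE oner_neq0.
- by rewrite S0 T0.
move=> t tI; have [j dj] := dom_cover (f t).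
have [b Hb] := path_coef_bounded oW Aconn fW tI dj.
exists (fun r => \tr (- path_coef A f j r)), b; apply: filterS Hb => s [ds sI hs].
split=> //; [apply: cderive_eq (dS s j sI ds 0 0) _|apply: cderive_eq (dT s j sI ds 0 0) _];
  by rewrite mxE big_ord1 /mxtrace big_ord1.
Qed.

End PathsAndFlows.

(** * Coordinate lines *)

Section CoordinateLines.
Variables (R : realType) (m : nat) (M : smoothManifold R m).
Local Notation C := R[i].
Variables (W : set M) (i : chart M) (a : 'I_m) (p : 'rV[R]_m).
Hypothesis oW : open W.

Definition coord_line (r : R) (t : R) : M :=
  param i (p + t *: (r *: delta_mx 0 a)).

(** A neighbourhood of [0, 1] in the parameter is asked to stay in the chart, as
    [smooth_path] requires. *)
Definition line_in (r : R) : Prop := forall t : R, -1 < t < 2 ->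
  (coord i @` (W `&` dom i)) (p + t *: (r *: delta_mx 0 a)).

Lemma coord_lineE r (t : R) : line_in r -> -1 < t < 2 ->
  [/\ W (coord_line r t), dom i (coord_line r t) &
      coord i (coord_line r t) = p + t *: (r *: delta_mx 0 a)].
Proof.
by move=> lr /lr[x [Wx dx] xE]; rewrite /coord_line -xE coordK.
Qed.

Lemma line_in_scale (s r : R) : 0 < s <= 1 -> line_in r -> line_in (s * r).
Proof.
move=> /andP[s0 s1] lr t /andP[t1 t2].
rewrite -scalerA scalerA; apply: lr; apply/andP; split; nra.
Qed.

Lemma coord_line_scale (s r t : R) : coord_line (s * r) t = coord_line r (s * t).
Proof. by rewrite /coord_line -!scalerA scalerA mulrC -scalerA. Qed.

Lemma coord_line_continuous r (t : R) : line_in r -> -1 < t < 2 ->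
  {for t, continuous (coord_line r)}.
Proof.
move=> lr tI.
apply: (@continuous_comp _ _ _ (fun t : R => p + t *: (r *: delta_mx 0 a)) (param i)).
  by apply: cvgD; [exact: cvg_cst|apply: cvgZl; exact: cvg_id].
by apply: param_continuous; have [x [_ dx] xE] := lr t tI; exists x.
Qed.

Lemma coord_line_path r : line_in r -> smooth_path W (coord_line r).
Proof.
move=> lr; split=> [t /andP[t0 t1]|].
  by have [] := @coord_lineE r t lr; first by apply/andP; split; lra.
have itv (t : R) : - 1 < t < 1 + 1 -> -1 < t < 2 by case/andP=> ? ?; apply/andP; split; lra.
exists 1; split=> // [t /itv tI|j b k]; first exact: coord_line_continuous.
apply: Ck_sub (Ck_line p (r *: delta_mx 0 a) (transition_smooth i j b k)).
move=> t [/itv tI dt]; have [_ di cE] := coord_lineE lr tI.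
by exists (coord_line r t).
Qed.

Lemma coord_line_velocity r (t : R) j b : line_in r -> -1 < t < 2 ->
  dom j (coord_line r t) ->
  velocity (coord_line r) j b t =
  r * 'D_(delta_mx 0 a) (fun u => coord j (param i u) ord0 b)
        (coord i (coord_line r t)).
Proof.
move=> lr tI dt; have [_ di cE] := coord_lineE lr tI.
pose F u := coord j (param i u) ord0 b.
have [_ /(_ (delta_mx 0 a)) [dF _]] := transition_smooth i j b 1%N.
have dx : derivable F (p + t *: (r *: delta_mx 0 a)) (delta_mx 0 a).
  by rewrite -cE; apply: dF; exists (coord_line r t).
rewrite cE; apply: etrans (line_derive F _ _ _ _) _; rewrite scale1r.
exact: (@derive_val _ _ _ _ _ _ _ (is_derive_scale r (derivableP dx))).
Qed.

(** The velocity in another chart is a directional derivative of the transition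
    map, just what the transformation law of connection forms contains. *)
Lemma coord_line_coef k (A : conn M k) r (t : R) j : is_connection W A ->
  line_in r -> -1 < t < 2 -> dom j (coord_line r t) ->
  path_coef A (coord_line r) j t = r%:C *: A i a (coord_line r t).
Proof.
move=> [_ Achg] lr tI dt; have [Wt di cE] := coord_lineE lr tI.
rewrite (Achg i j a _ Wt di dt) scaler_sumr; apply: eq_bigr => b _.
by rewrite scalerA coord_line_velocity // rmorphM.
Qed.

(** Reparametrising a solution T by s t gives a solution along the line shortened
    by the factor s, since that multiplies the velocity by s. *)
Lemma coord_line_transport k (A : conn M k) r : is_connection W A -> line_in r ->
  exists2 T, flow A (coord_line r) T &
    forall s : R, 0 < s <= 1 -> transport A (coord_line (s * r)) (T s).
Proof.
move=> Aconn lr.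
(* Clamping the time extends the coefficient continuously to the whole line. *)
pose B t := - (r%:C *: A i a (coord_line r (clamp t))).
have clampI (t : R) : -1 < clamp t < 2.
  by have /andP[? ?] := clamp_itv t; apply/andP; split; lra.
have cB u c : continuous (fun t => complex.Re (B t u c)) /\
              continuous (fun t => complex.Im (B t u c)).
  have oWi : open (W `&` dom i) by exact: openI oW (@dom_open _ _ M i).
  have [sR sI] := Aconn.1 i a u c.
  have cc (g : M -> R) : smoothR (W `&` dom i) g ->
      continuous (fun t => g (coord_line r (clamp t))).
    move=> sg t; have [Wt di _] := coord_lineE lr (clampI t).
    have c1 : {for t, continuous (coord_line r \o @clamp R)}.
      by apply: continuous_comp; [exact: clamp_continuous|exact: coord_line_continuous].
    have c2 : {for coord_line r (clamp t), continuous g}.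
      exact: smoothR_continuous sg _.
    exact: (@continuous_comp _ _ _ (coord_line r \o @clamp R) g).
  have Bre t : complex.Re (B t u c) = - r * complex.Re (A i a (coord_line r (clamp t)) u c).
    by rewrite !mxE Re_opp Re_mulC mulNr.
  have Bim t : complex.Im (B t u c) = - r * complex.Im (A i a (coord_line r (clamp t)) u c).
    by rewrite !mxE Im_opp Im_mul /= mul0r addr0 mulNr.
  split.
    under [X in continuous X]eq_fun do rewrite Bre.
    by move=> t; apply: cvgM; [exact: cvg_cst|exact: (cc _ sR)].
  under [X in continuous X]eq_fun do rewrite Bim.
  by move=> t; apply: cvgM; [exact: cvg_cst|exact: (cc _ sI)].
have [T [T0 cT dT]] := matrix_ode_exists cB.
have flowT (s : R) : 0 < s <= 1 -> flow A (coord_line (s * r)) (fun t => T (s * t)).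
  move=> sI; have [s0 s1] := andP sI.
  split=> [|u c|t j tI dt u c]; first by rewrite mulr0.
    have [c1 c2] := cT u c.
    have cs t : {for t, continuous (fun t : R => s * t)}.
      by apply: cvgM; [exact: cvg_cst|exact: cvg_id].
    split; apply: continuous_subspaceT => t.
      exact: (@continuous_comp _ _ _ (fun t : R => s * t)
        (fun t => complex.Re (T t u c)) t (cs t) (c1 _)).
    exact: (@continuous_comp _ _ _ (fun t : R => s * t)
      (fun t => complex.Im (T t u c)) t (cs t) (c2 _)).
  have stI : 0 < s * t < 1 by case/andP: tI => ? ?; apply/andP; split; nra.
  have [d1 d2] := dT _ stI u c.
  have tI2 : -1 < t < 2 by case/andP: tI => ? ?; apply/andP; split; lra.
  rewrite (coord_line_coef Aconn (line_in_scale sI lr) tI2 dt) coord_line_scale.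
  have -> : (- ((s * r)%:C *: A i a (coord_line r (s * t))) *m T (s * t)) u c =
      s%:C * (B (s * t) *m T (s * t)) u c.
    rewrite /B clamp_id; last by case/andP: stI => /ltW -> /ltW ->.
    by rewrite rmorphM -scalerA -scalerN -scalemxAl mxE.
  split.
    by rewrite Re_mulC; exact: is_derive_comp_mull d1.
  have -> : complex.Im (s%:C * (B (s * t) *m T (s * t)) u c) =
      s * complex.Im ((B (s * t) *m T (s * t)) u c).
    by rewrite Im_mul /= mul0r addr0.
  exact: is_derive_comp_mull d2.
exists T.
  have := flowT 1; rewrite lexx ltr01 mul1r => /(_ isT).
  by under [X in flow _ _ X]eq_fun do rewrite mul1r.
by move=> s sI; apply/transportP; exists (fun t => T (s * t)); [exact: flowT|rewrite mulr1].
Qed.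

End CoordinateLines.

(** * The connection induced by Dger *)

Section DgerConnection.
Variables (R : realType) (m n : nat) (M : smoothManifold R m).
Local Notation C := R[i].

Definition dger_conn (E : mob n) (A : mconn M E) : conn M 1 := fun i a x =>
  (\sum_j \sum_k \tr (A j k i a x) *~ dger_exp E j k)%:M.

Lemma trace_dger_conn (E : mob n) (A : mconn M E) i a x : \tr (dger_conn A i a x) =
  \sum_j \sum_k \tr (A j k i a x) *~ dger_exp E j k.
Proof. by rewrite mxtrace_scalar mulr1n. Qed.

Lemma mx11_trace_inj (X Y : 'M[C]_1) : \tr X = \tr Y -> X = Y.
Proof.
by rewrite /mxtrace !big_ord1 => XY; apply/matrixP => r c; rewrite !ord1.
Qed.

Lemma trace_sum k (I : Type) (r : seq I) (P : pred I) (F : I -> 'M[C]_k) :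
  \tr (\sum_(b <- r | P b) F b) = \sum_(b <- r | P b) \tr (F b).
Proof. exact: raddf_sum. Qed.

Lemma trace_path_coef_dger (E : mob n) (A : mconn M E) f i t :
  \tr (- path_coef (dger_conn A) f i t) =
  \sum_j \sum_k \tr (- path_coef (A j k) f i t) *~ dger_exp E j k.
Proof.
rewrite trace_path_coef.
under eq_bigr do rewrite trace_dger_conn mulr_sumr.
rewrite exchange_big -sumrN; apply: eq_bigr => j _ /=.
under eq_bigr do rewrite mulr_sumr.
rewrite exchange_big -sumrN; apply: eq_bigr => k _ /=.
rewrite trace_path_coef mulNrz mulrz_suml; congr (- _); apply: eq_bigr => b _.
by rewrite mulrzAr.
Qed.

Lemma dger_conn_connection (E : mob n) (A : mconn M E) (W : set M) : open W ->
  (forall j k, is_connection W (A j k)) -> is_connection W (dger_conn A).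
Proof.
move=> oW Aconn; split=> [i a r c|i j a x Wx di dj].
  have oWi : open (W `&` dom i) by exact: openI oW (@dom_open _ _ M i).
  have alg := smoothC_algebra oWi.
  have -> : (fun x => dger_conn A i a x r c) =
      (fun x => \sum_j \sum_k \tr (A j k i a x) * (dger_exp E j k)%:~R).
    apply/funext => x; rewrite mxE !ord1 eqxx mulr1n.
    by apply: eq_bigr => j _; apply: eq_bigr => k _; rewrite mulrzr.
  apply: (algebra_sum alg) => j; apply: (algebra_sum alg) => k.
  apply: smoothCM => //; last exact: smoothC_cst.
  by apply: (algebra_sum alg) => l; exact: (Aconn j k).1.
apply: mx11_trace_inj; rewrite trace_dger_conn trace_sum.
under [RHS]eq_bigr do rewrite mxtraceZ trace_dger_conn mulr_sumr.
rewrite [RHS]exchange_big; apply: eq_bigr => k _ /=.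
under [RHS]eq_bigr do rewrite mulr_sumr.
rewrite [RHS]exchange_big; apply: eq_bigr => l _ /=.
rewrite ((Aconn k l).2 i j a x Wx di dj) trace_sum mulrz_suml.
by apply: eq_bigr => b _; rewrite mxtraceZ mulrzAr.
Qed.

(** Dger of the transports is prod det(T_jk)^(K_jk); its logarithmic derivative is
    the K-weighted sum of those of the det(T_jk), given by Liouville. *)
Lemma dger_conn_transport (E : glob n) (A : mconn M E) (W : set M) : open W ->
  (forall j k, is_connection W (A j k)) -> Dger_transport W A (dger_conn A).
Proof.
move=> oW Aconn f P fW tP.
have tE j k := (transportP (A j k) f (iso_aut (P j k))).1 (tP j k).
pose T j k := s2val (cid2 (tE j k)).
have fT j k : flow (A j k) f (T j k) := s2valP (cid2 (tE j k)).
have T1 j k : T j k 1 = iso_aut (P j k) := s2valP' (cid2 (tE j k)).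
pose S t := \prod_j \prod_k \det (T j k t) ^ dger_exp E j k.
have logdS (t : R) i : 0 < t < 1 -> dom i (f t) ->
    logd S t (1 : R) (\tr (- path_coef (dger_conn A) f i t)).
  move=> tI dt; rewrite trace_path_coef_dger.
  apply: logd_prod => j; apply: logd_prod => k; apply: logd_exprz.
  exact: (flow_det oW (Aconn j k) fW (fT j k) tI dt).
have detT0 j k (t : R) : 0 <= t <= 1 -> \det (T j k t) != 0.
  move=> tI; have [T0 _ _] := fT j k.
  have [->|t0] := eqVneq t 0; first by rewrite T0 det1 oner_neq0.
  have [->|t1] := eqVneq t 1.
    by rewrite T1; have := iso_unit (P j k); rewrite unitmxE unitfE.
  have tI' : 0 < t < 1.
    by case/andP: tI => ? ?; rewrite !lt_neqAle [0 == t]eq_sym t0 t1; apply/andP.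
  have [i di] := dom_cover (f t).
  by have [] := flow_det oW (Aconn j k) fW (fT j k) tI' di.
apply/transportP; exists (fun t => (S t)%:M); last first.
  congr (_ %:M); rewrite DgerE mul1r /S.
  by apply: eq_bigr => j _; apply: eq_bigr => k _; rewrite T1.
split=> [|r c|t i tI dt r c].
- congr (_ %:M); rewrite /S big1 // => j _; rewrite big1 // => k _.
  by have [-> _ _] := fT j k; rewrite det1 exp1rz.
- under [X in ccontinuous_on X]eq_fun do rewrite mxE !ord1 eqxx mulr1n.
  apply: (algebra_prod (@ccontinuous_algebra R)) => j.
  apply: (algebra_prod (@ccontinuous_algebra R)) => k.
  apply: (algebra_exprz (@ccontinuous_algebra R)).
    by move=> t; rewrite /= in_itv /=; exact: detT0.
  by apply: (algebra_det (@ccontinuous_algebra R)); have [] := fT j k.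
- under [X in cderive X]eq_fun do rewrite mxE !ord1 eqxx mulr1n.
  apply: cderive_eq (logdS t i tI dt).2 _.
  by rewrite mul_mx_scalar [RHS]mxE !ord1 mulrC /mxtrace big_ord1.
Qed.

(** Take a coordinate line through x in the direction a.  Up to each intermediate
    time s the transport of D is prescribed to be Dger of that of A, so the
    logarithmic derivatives of both at x agree; they are the same multiple of the
    components along a of the two connection forms. *)
Lemma dger_conn_unique (E : glob n) (A : mconn M E) (W : set M) (D : conn M 1) :
  open W -> (forall j k, is_connection W (A j k)) -> is_connection W D ->
  Dger_transport W A D -> eq_conn W D (dger_conn A).
Proof.
move=> oW Aconn Dconn DD i a x Wx dx.
pose delta : 'rV[R]_m := delta_mx 0 a.
(* The line passes through x at time 1/2, an interior point of [0, 1]. *)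
have [r [r0 lr]] : exists r : R, 0 < r /\
    line_in W i a (coord i x - 2^-1 *: (r *: delta)) r.
  have : nbhs (coord i x) (coord i @` (W `&` dom i)).
    by apply: open_nbhs_nbhs; split; [exact: open_coord|exists x].
  move=> /nbhs_ballP[e /= e0 He]; pose N := 2 * (`|delta| + 1).
  have N0 : 0 < N by rewrite mulr_gt0 // ltr_wpDl ?normr_ge0.
  exists (e / N); split; first by rewrite divr_gt0.
  move=> t /andP[t1 t2]; apply: He; rewrite -ball_normE /=.
  rewrite opprD addrA opprB addrCA subrr addr0 -scalerBl normrZ normrZ.
  have tb : `|2^-1 - t| <= 3 / 2 by rewrite ler_norml; apply/andP; split; lra.
  rewrite [`|e / N|]ger0_norm ?divr_ge0 ?ltW //.
  have eN : 0 < e / N by rewrite divr_gt0.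
  have d0 : 0 <= `|delta| by exact: normr_ge0.
  have eE : e = e / N * N by rewrite divfK // gt_eqF.
  rewrite [ltRHS]eE; apply: (@le_lt_trans _ _ (3 / 2 * (e / N * `|delta|))).
    by rewrite ler_wpM2r // mulr_ge0 // ltW.
  rewrite mulrCA ltr_pM2l // /N; lra.
set p := coord i x - 2^-1 *: (r *: delta) in lr.
pose f := coord_line i a p r.
have fh : f 2^-1 = x by rewrite /f /coord_line subrK coordK.
have fW : smooth_path W f by exact: coord_line_path.
have [S fS tS] := coord_line_transport oW Dconn lr.
have tE j k := coord_line_transport oW (Aconn j k) lr.
pose T j k := s2val (cid2 (tE j k)).
have fT j k : flow (A j k) f (T j k) := s2valP (cid2 (tE j k)).
have tT j k : forall s : R, 0 < s <= 1 ->
  transport (A j k) (coord_line i a p (s * r)) (T j k s) := s2valP' (cid2 (tE j k)).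
pose G t := \prod_j \prod_k \det (T j k t) ^ dger_exp E j k.
have SG (s : R) : 0 < s < 1 -> \det (S s) = G s.
  move=> sI; have sI' : 0 < s <= 1 by case/andP: sI => -> /ltW ->.
  have uT j k : T j k s \in unitmx.
    have [l dl] := dom_cover (f s).
    rewrite unitmxE unitfE.
    by have [] := flow_det oW (Aconn j k) fW (fT j k) sI dl.
  pose P : mmor R E E := fun j k => Iso (erefl (glob_mob E j k)) (uT j k).
  have lsr := line_in_scale sI' lr.
  have fsW := coord_line_path lsr.
  have := DD _ P fsW (fun j k => tT j k s sI').
  move=> /(flow_unique1 oW Dconn fsW (tS s sI')) ->.
  by rewrite det_scalar1 DgerE mul1r.
have hI : 0 < (2^-1 : R) < 1 by apply/andP; split; lra.
have hI2 : -1 < (2^-1 : R) < 2 by apply/andP; split; lra.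
have dfx : dom i (f 2^-1) by rewrite fh.
have [S0 [dS1 dS2]] := flow_det oW Dconn fW fS hI dfx.
have [_ [dG1 dG2]] : logd G 2^-1 (1 : R) (\tr (- path_coef (dger_conn A) f i 2^-1)).
  rewrite trace_path_coef_dger.
  apply: logd_prod => j; apply: logd_prod => k; apply: logd_exprz.
  exact: (flow_det oW (Aconn j k) fW (fT j k) hI dfx).
have nSG : \forall s \near (2^-1 : R), \det (S s) = G s.
  have : \forall s \near (2^-1 : R), s \in `]0, 1[ by apply: near_in_itvoo; rewrite in_itv.
  by apply: filterS => s; rewrite in_itv; exact: SG.
have [dH1 dH2] := cderive_near nSG (conj dS1 dS2).
have : \tr (- path_coef D f i 2^-1) = \tr (- path_coef (dger_conn A) f i 2^-1).
  apply: (mulIf S0); rewrite [in RHS](nbhs_singleton nSG).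
  apply: complex_eqP.
    by rewrite -(@derive_val _ _ _ _ _ _ _ dH1) -(@derive_val _ _ _ _ _ _ _ dG1).
  by rewrite -(@derive_val _ _ _ _ _ _ _ dH2) -(@derive_val _ _ _ _ _ _ _ dG2).
have Aconn' := dger_conn_connection oW Aconn.
rewrite (coord_line_coef Dconn lr hI2 dfx) (coord_line_coef Aconn' lr hI2 dfx).
rewrite -/f fh => /mx11_trace_inj/oppr_inj/scalerI; apply.
by rewrite (fmorph_eq0 (real_complex R)) gt_eqF.
Qed.

End DgerConnection.

(** * Compatibility with the 2-cocycle *)

Section Gerbe.
Variables (R : realType) (m : nat) (M : smoothManifold R m).
Local Notation C := R[i].

Lemma partialP (W : set M) (g : M -> C) (i : chart M) a x :
  smoothC W g -> W x -> dom i x ->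
  cderive (fun u => g (param i u)) (coord i x) (delta_mx 0 a) (partial i a g x).
Proof.
move=> [sR sI] Wx dx.
have [_ /(_ (delta_mx 0 a)) [dR _]] := sR i 1%N.
have [_ /(_ (delta_mx 0 a)) [dI _]] := sI i 1%N.
have cx : (coord i @` (W `&` dom i)) (coord i x) by exists x.
by split; apply: derivableP; [exact: dR|exact: dI].
Qed.

Lemma partial_val (g : M -> C) (i : chart M) a x l :
  cderive (fun u => g (param i u)) (coord i x) (delta_mx 0 a) l ->
  partial i a g x = l.
Proof. by move=> [[_ d1] [_ d2]]; apply: complex_eqP. Qed.

(** The compatibility condition on the constant sections of a basis reads
    d phi = phi A - B phi. *)
Lemma coherency_logd p q (W : set M) (phi : M -> iso R p q) (B : conn M q)
    (A : conn M p) i a x : open W -> smooth_mx W (fun y => iso_aut (phi y)) ->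
  pullback_conn_eq W (fun y => iso_mx (phi y)) B A -> W x -> dom i x ->
  logd (fun u => \det (iso_aut (phi (param i u)))) (coord i x) (delta_mx 0 a)
    (\tr (A i a x) - \tr (B i a x)).
Proof.
have e := iso_eq (phi x); case: q / e phi B => phi B oW sphi AB Wx dx.
have phiE y : iso_mx (phi y) = iso_aut (phi y) by rewrite /iso_mx castmx_id.
split; first by rewrite coordK // iso_det_subproof.
have dphi r c := partialP a (sphi r c) Wx dx.
apply: cderive_eq (cderive_det_mul (A := - B i a x) (B := A i a x) _) _; last first.
  by rewrite raddfN /= addrC.
move=> r c; apply: cderive_eq (dphi r c) _; rewrite coordK //.
pose s := (fun=> delta_mx c 0) : M -> 'cV[C]_p.
have ss : smooth_mx W s by move=> ? ?; exact: smoothC_cst.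
have := congr1 (fun X : 'cV[C]_p => X r 0) (AB s ss i a x Wx dx).
have colE (X : 'M[C]_p) : (X *m delta_mx c 0 : 'cV[C]_p) r 0 = X r c.
  by rewrite -colE mxE.
rewrite /nabla mxE [X in X + _]mxE.
have -> : (fun y => (iso_mx (phi y) *m s y) r 0) = (fun y => iso_aut (phi y) r c).
  by apply/funext => y; rewrite colE phiE.
have -> : partial_mx i a s x = 0.
  apply/matrixP => r' c'; rewrite mxE [RHS]mxE; apply: partial_val.
  exact: (cderive_cst ((delta_mx c 0 : 'cV[C]_p) r' c')).
rewrite add0r !mulmxA !colE phiE => e.
by rewrite mulNmx mxE [X in X + _]mxE addrC -e addrK.
Qed.

(** The Leibniz rule, for line bundles. *)
Lemma pullback_conn_logd (W : set M) (g : M -> C) (B A : conn M 1) :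
  smoothC W g ->
  (forall i a x, W x -> dom i x ->
    logd (fun u => g (param i u)) (coord i x) (delta_mx 0 a)
      (\tr (A i a x) - \tr (B i a x))) ->
  pullback_conn_eq W (fun x => (g x)%:M) B A.
Proof.
move=> sg gAB s ss i a x Wx dx; apply/matrixP => r c; rewrite !ord1.
have [_ dg] := gAB i a x Wx dx; have ds := partialP a (ss 0 0) Wx dx.
have := cderiveM dg ds; rewrite coordK // => dgs.
rewrite /nabla !mul_scalar_mx -scalemxAr.
rewrite !mxE !big_ord1.
have -> : (fun y => ((g y)%:M *m s y) 0 0) = (fun y => g y * s y 0 0).
  by apply/funext => y; rewrite mul_scalar_mx mxE.
rewrite (partial_val dgs) /mxtrace !big_ord1; ring.
Qed.

Lemma trace_tensor_conn p q (A : conn M p) (B : conn M q) i a x :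
  \tr (tensor_conn A B i a x) = \tr (A i a x) *+ q + \tr (B i a x) *+ p.
Proof.
by rewrite /tensor_conn mxtraceD !mxtrace_tens !mxtrace1 mulr_natr mulr_natl.
Qed.

Lemma trace_mconn_mul n (E F : mob n) (A : mconn M E) (B : mconn M F) i k c a x :
  \tr (mconn_mul A B i k c a x) =
  \sum_j (\tr (A i j c a x) *+ F j k + \tr (B j k c a x) *+ E i j).
Proof.
rewrite /mconn_mul /sum_conn mxtrace_mxdiag; apply: eq_bigr => j _.
exact: trace_tensor_conn.
Qed.

(** The K-weighted sum of the logarithmic derivatives of the det(phi_jk): the terms
    of the product connection recombine by [dger_exp_pairing], and the sign is
    locally constant. *)
Lemma Dger_logd n (E F G : glob n) (W : set M)
    (phi : M -> mmor R (glob_mul E F) G * bool)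
    (A : mconn M E) (B : mconn M F) (D : mconn M G) i a x :
  open W -> mob_mul E F = G ->
  (forall j k, smooth_mx W (fun y => iso_aut ((phi y).1 j k))) ->
  (forall y, W y -> \forall z \near y, W z -> (phi z).2 = (phi y).2) ->
  (forall j k, pullback_conn_eq W (fun y => iso_mx ((phi y).1 j k)) (D j k)
    (mconn_mul A B j k)) ->
  W x -> dom i x ->
  logd (fun u => val (Dger (phi (param i u)))) (coord i x) (delta_mx 0 a)
    (\tr (dger_conn A i a x) + \tr (dger_conn B i a x) - \tr (dger_conn D i a x)).
Proof.
move=> oW EFG sphi lsign ABD Wx dx.
pose K := dger_exp (mob_mul E F).
pose h u := \prod_j \prod_k \det (iso_aut ((phi (param i u)).1 j k)) ^ K j k.
have logdh : logd h (coord i x) (delta_mx 0 a)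
    (\sum_j \sum_k (\tr (mconn_mul A B j k i a x) - \tr (D j k i a x)) *~ K j k).
  apply: logd_prod => j; apply: logd_prod => k; apply: logd_exprz.
  exact: coherency_logd (sphi j k) (ABD j k) Wx dx.
have s0 : (-1) ^+ (phi x).2 != 0 :> C by rewrite signr_eq0.
have := logdM (logd_cst (coord i x) (delta_mx 0 a) s0) logdh.
rewrite add0r => -[n0 d0].
have DgerW u : val (Dger (phi (param i u))) = (-1) ^+ (phi (param i u)).2 * h u.
  by rewrite /h; case: (phi (param i u)) => f s; exact: DgerE.
have lx : (-1) ^+ (phi x).2 * h (coord i x) = val (Dger (phi (param i (coord i x)))).
  by rewrite DgerW coordK.
have nx : \forall u \near coord i x,
    (-1) ^+ (phi x).2 * h u = val (Dger (phi (param i u))).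
  have : nbhs (param i (coord i x)) [set y | (phi y).2 = (phi x).2].
    rewrite coordK //; apply: filterS2 (lsign x Wx) (open_nbhs_nbhs (conj oW Wx)).
    by move=> y; apply.
  have ux : (coord i @` dom i) (coord i x) by exists x.
  move=> /(param_continuous ux) nphi; near=> u.
  rewrite DgerW; congr ((-1) ^+ nat_of_bool _ * _); apply/esym.
  by near: u; exact: nphi.
split; first by rewrite -lx.
apply: cderive_eq (cderive_near nx d0) _; rewrite lx; congr (_ * _).
rewrite !trace_dger_conn -dger_exp_pairing.
have -> : dger_exp G = K by rewrite /K EFG.
rewrite -sumrB; apply: eq_bigr => j _; rewrite -sumrB; apply: eq_bigr => k _.
by rewrite mulrzBl trace_mconn_mul.
Unshelve. all: by end_near. Qed.

Lemma smooth_Dger n (E G : glob n) (W : set M) (phi : M -> mmor R E G * bool) :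
  open W -> (forall j k, smooth_mx W (fun y => iso_aut ((phi y).1 j k))) ->
  (forall y, W y -> \forall z \near y, W z -> (phi z).2 = (phi y).2) ->
  smoothC W (fun y => val (Dger (phi y))).
Proof.
move=> oW sphi lsign; have alg := smoothC_algebra oW.
have -> : (fun y => val (Dger (phi y))) = (fun y => (-1) ^+ (phi y).2 *
    \prod_j \prod_k \det (iso_aut ((phi y).1 j k)) ^ dger_exp E j k).
  by apply/funext => y; case: (phi y) => f s; rewrite DgerE.
apply: smoothCM => //.
  by apply: smoothC_near_cst => // x Wx; apply: filterS (lsign x Wx) => y sy Wy;
     rewrite sy.
apply: (algebra_prod alg) => j; apply: (algebra_prod alg) => k.
apply: (algebra_exprz alg) => [y _|]; first exact: iso_det_subproof.
exact: (algebra_det alg) (sphi j k).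
Qed.

End Gerbe.

(** The image under Dger of the coherence condition of a bundle; the identities and
    the associator go to 1. *)
Lemma Dger_cocycle (R : realType) (n : nat) (X Y Z XY YZ XYZ : glob n)
    (p1 : mmor R (glob_mul X YZ) XYZ * bool)
    (p2 : mmor R (glob_mul Y Z) YZ * bool)
    (p3 : mmor R (glob_mul XY Z) XYZ * bool)
    (p4 : mmor R (glob_mul X Y) XY * bool) :
  (mmor_comp p1.1 (mmor_mul (mmor_id R X) p2.1), p1.2 (+) (false (+) p2.2)) =
  (mmor_comp p3.1 (mmor_comp (mmor_mul p4.1 (mmor_id R Z)) (massoc R X Y Z)),
   p3.2 (+) (p4.2 (+) false (+)
     @sgn R n (glob_mul X (glob_mul Y Z)) (glob_mul (glob_mul X Y) Z)
       (massoc R X Y Z))) ->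
  cstar_mul (Dger p1) (cstar_mul (cstar1 R) (Dger p2)) =
  cstar_mul (Dger p3) (cstar_mul (cstar_mul (Dger p4) (cstar1 R)) (cstar1 R)).
Proof.
case: p1 p2 p3 p4 => [f1 s1] [f2 s2] [f3 s3] [f4 s4].
move=> /(congr1 (@Dger R n (glob_mul X (glob_mul Y Z)) XYZ)) /=.
rewrite (@Dger_comp _ _ _ (glob_mul X YZ)) (@Dger_comp _ _ _ (glob_mul XY Z)).
rewrite (@Dger_comp _ _ _ (glob_mul (glob_mul X Y) Z)) !Dger_mul !Dger_id.
by rewrite Dger_assoc (Dger_mul (mmor_id R X) f2 false s2) Dger_id.
Qed.

Theorem mainTheorem8 (R : realType) (m n : nat) (n_gt0 : (0 < n)%N)
    (M : smoothManifold R m)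
    (M_paracompact : paracompact M)
    (M_partitions : has_smooth_partitions_of_unity M)
    (d : Order.disp_t) (J : porderType d) (U : J -> set M)
    (E : bundleData J (OGl M n)) (E_bundle : is_bundle U E)
    (A : forall a b : J, mconn M (bundle_ob E a b))
    (A_connective : is_connective U A) :
  is_bundle U (Dger_bundle E) /\
  (forall a b : J, (a < b)%O ->
     exists D : conn M 1,
       [/\ is_connection (U a `&` U b) D,
           Dger_transport (U a `&` U b) (A a b) D &
           forall D' : conn M 1, is_connection (U a `&` U b) D' ->
             Dger_transport (U a `&` U b) (A a b) D' ->
             eq_conn (U a `&` U b) D D']) /\
  (forall D : J -> J -> conn M 1,
     (forall a b : J, (a < b)%O ->
        is_connection (U a `&` U b) (D a b) /\
        Dger_transport (U a `&` U b) (A a b) (D a b)) ->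
     is_gerbe_connective U (Dger_bundle E) D).
Proof.
have [[[oU cU] totU] obE smE cocE] := E_bundle.
have [Aconn Apull] := A_connective.
have oU2 a b : open (U a `&` U b) by apply: openI; exact: oU.
have oU3 a b c : open (U a `&` U b `&` U c) by apply: openI => //; exact: oU.
have smDger a b c (ab : (a < b)%O) (bc : (b < c)%O) :
    smoothC (U a `&` U b `&` U c) (fun x => val (Dger (bundle_mor E ab bc x))).
  by have [s1 s2] := smE a b c ab bc; exact: smooth_Dger.
split; last split.
- split=> // a b c e ab bc ce x Ux.
  exact: Dger_cocycle (cocE a b c e ab bc ce x Ux).
- move=> a b ab; exists (dger_conn (A a b)); split.
  + by apply: dger_conn_connection => //; exact: Aconn.
  + by apply: dger_conn_transport => //; exact: Aconn.
  + move=> D' D'conn D'trans i c x Wx dx; apply/esym.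
    by apply: dger_conn_unique D'trans _ _ _ Wx dx => //; exact: Aconn.
move=> D DP; split=> [a b /DP[]//|a b c ab bc].
apply: (@pullback_conn_logd R m M _ _ _ (tensor_conn (D a b) (D b c) : conn M 1)).
  exact: smDger.
move=> i k x Ux dx.
have DE a' b' (lt : (a' < b')%O) : (U a' `&` U b') x ->
    \tr (D a' b' i k x) = \tr (dger_conn (A a' b') i k x).
  move=> Ux'; have [Dc Dt] := DP a' b' lt.
  by rewrite (dger_conn_unique (oU2 a' b') (Aconn a' b' lt) Dc Dt).
have [[Ua Ub] Uc] := Ux.
have [s1 s2] := smE a b c ab bc.
have EFG := congr1 (@glob_mob n) (obE a b c ab bc).
have L := Dger_logd k (oU3 a b c) EFG s1 s2 (Apull a b c ab bc) Ux dx.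
apply: (logd_eq L).
rewrite -!DE //; last exact: (lt_trans ab bc).
congr (_ - _); apply: esym. exact: (trace_tensor_conn (D a b) (D b c) i k x).
Qed.
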